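(* Precomposition with the desuspension functor and with the reduced suspension functor define an equivalence of categories between $\mathrm{Mod}(\mathrm{Syn}(\mathsf{MCaTT}))$ and the full subcategory of $\mathrm{Mod}(\mathrm{Syn}(\mathsf{CaTT}))$ on those models $F$ with $F(D^0)$ a singleton.
   Context: $\mathsf{CaTT}$ is the Finster–Mimram type theory for weak $\omega$-categories (types $\star$, $\mathrm{Hom}_Atu$; term constructors $\mathsf{op}$, $\mathsf{coh}$ indexed by ps-contexts). $\mathsf{MCaTT}$ is the type theory with a unit type $\mathbb{1}$ (constant $()$, $\eta$-rule identifying all terms of type $\mathbb{1}$ with $()$), types $\mathrm{Hom}_Atu$ ($\star$ abbreviating $\mathrm{Hom}_{\mathbb{1}}()()$), and term constructors $\mathsf{mop}_{\Gamma,A}[\gamma]$, $\mathsf{mcoh}_{\Gamma,A}[\gamma]$ for $\Gamma$ a ps-context and $A$ a valid operation/coherence type in $\mathsf{CaTT}$, with $\gamma$ a substitution into the desuspension of $\Gamma$. $\mathrm{Syn}(T)$ is the syntactic category with families; a model of a category with families $C$ is a functor $C\to\mathbf{Set}$ preserving the terminal object and pullbacks along display maps, and $\mathrm{Mod}(C)$ denotes the category of models. $D^0=(x:\star)$. The desuspension $\mathrm{D}:\mathrm{Syn}(\mathsf{CaTT})\to\mathrm{Syn}(\mathsf{MCaTT})$ is the morphism of categories with families replacing $\star$ by $\mathbb{1}$, $\mathsf{op}$ by $\mathsf{mop}$, $\mathsf{coh}$ by $\mathsf{mcoh}$; the reduced suspension $\Sigma_r:\mathrm{Syn}(\mathsf{MCaTT})\to\mathrm{Syn}(\mathsf{CaTT})$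 adds a fresh variable $\bullet:\star$, sends $\mathbb{1}$ to $\star$, $()$ to $\bullet$, $\star$ to $\mathrm{Hom}_\star\bullet\bullet$, drops variables of type $\mathbb{1}$, and sends $\mathsf{mop}_{\Theta,A}[\gamma]$ to $\mathsf{op}_{\Theta,A}[\bullet_\Theta\circ\Sigma_r\gamma]$ (similarly for $\mathsf{mcoh}$), where $\bullet_\Theta:\Sigma_r(\mathrm{D}\Theta)\to\Theta$ maps variables of type $\star$ to $\bullet$ and other variables to themselves. The functors of the equivalence are $F\mapsto F\circ\mathrm{D}$ and $F\mapsto F\circ\Sigma_r$. *)

(* Defs.v *)
From mathcomp Require Import all_boot.
From Stdlib Require List.
From Stdlib Require Import RelationClasses Morphisms Setoid.

Set Implicit Arguments.
Unset Strict Implicit.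
Unset Printing Implicit Defensive.

(** Hom-sets carry an equivalence relation instead of being quotiented, so
    that morphisms of a syntactic category can be substitutions modulo
    definitional equality.  "The category" meant is the one whose hom-sets are
    the quotients; functors respect the equivalences, hence are exactly the
    functors between the quotient categories. *)

Record Category := {
  obj :> Type;
  mor : obj -> obj -> Type;
  mor_eq : forall {X Y}, mor X Y -> mor X Y -> Prop;
  mor_eq_equiv : forall X Y, Equivalence (@mor_eq X Y);
  idc : forall X, mor X X;
  comp : forall {X Y Z}, mor Y Z -> mor X Y -> mor X Z;
  comp_proper : forall X Y Z (g g' : mor Y Z) (f f' : mor X Y),
    mor_eq g g' -> mor_eq f f' -> mor_eq (comp g f) (comp g' f');
  comp_idl : forall X Y (f : mor X Y), mor_eq (comp (idc Y) f) f;
  comp_idr : forall X Y (f : mor X Y), mor_eq (comp f (idc X)) f;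
  comp_assoc : forall X Y Z W (h : mor Z W) (g : mor Y Z) (f : mor X Y),
    mor_eq (comp h (comp g f)) (comp (comp h g) f) }.

Arguments idc {c} X.
Arguments mor {c} X Y.
Arguments mor_eq {c X Y} f g.
Arguments comp {c X Y Z} g f.
Existing Instance mor_eq_equiv.

#[global] Instance comp_Proper (C : Category) (X Y Z : C) :
  Proper (@mor_eq C Y Z ==> @mor_eq C X Y ==> @mor_eq C X Z) comp.
Proof. by move=> g g' eg f f' ef; apply: comp_proper. Qed.

Declare Scope cat_scope.
Delimit Scope cat_scope with cat.
Local Open Scope cat_scope.
Notation "f ≈ g" := (mor_eq f g) (at level 70) : cat_scope.
Notation "g ⊚ f" := (comp g f) (at level 40, left associativity) : cat_scope.

Record Functor (C D : Category) := {
  fobj :> C -> D;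
  fmor : forall {X Y : C}, mor X Y -> mor (fobj X) (fobj Y);
  fmor_proper : forall X Y (f g : mor X Y), f ≈ g -> fmor f ≈ fmor g;
  fmor_id : forall X, fmor (idc X) ≈ idc (fobj X);
  fmor_comp : forall X Y Z (g : mor Y Z) (f : mor X Y),
    fmor (g ⊚ f) ≈ fmor g ⊚ fmor f }.

Record NatTrans (C D : Category) (F G : Functor C D) := {
  component :> forall X : C, mor (F X) (G X);
  naturality : forall X Y (f : mor X Y),
    fmor G f ⊚ component X ≈ component Y ⊚ fmor F f }.

Definition is_iso (C : Category) (X Y : C) (f : mor X Y) : Prop :=
  exists g : mor Y X, g ⊚ f ≈ idc X /\ f ⊚ g ≈ idc Y.

Definition naturally_isomorphic (C D : Category) (F G : Functor C D) : Prop :=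
  exists a : NatTrans F G, forall X, is_iso (a X).

Definition is_terminal (C : Category) (T : C) : Prop :=
  forall X : C, exists f : mor X T, forall g : mor X T, g ≈ f.

Definition is_pullback (C : Category) (P X Y Z : C)
    (a : mor P X) (b : mor P Y) (f : mor X Z) (g : mor Y Z) : Prop :=
  f ⊚ a ≈ g ⊚ b /\
  forall (W : C) (u : mor W X) (v : mor W Y), f ⊚ u ≈ g ⊚ v ->
    exists w : mor W P, (a ⊚ w ≈ u /\ b ⊚ w ≈ v) /\
      forall w' : mor W P, a ⊚ w' ≈ u -> b ⊚ w' ≈ v -> w' ≈ w.

Program Definition SetCat : Category :=
  {| obj := Type; mor := fun X Y => X -> Y;
     mor_eq := fun X Y f g => forall x, f x = g x;
     idc := fun X x => x; comp := fun X Y Z g f x => g (f x) |}.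
Next Obligation.
split; [by move=> f x | by move=> f g e x | by move=> f g h e e' x; rewrite e].
Qed.
Next Obligation. by rewrite H0 H. Qed.

Program Definition id_functor (C : Category) : Functor C C :=
  {| fobj := fun X => X; fmor := fun X Y f => f |}.
Next Obligation. reflexivity. Qed.
Next Obligation. reflexivity. Qed.

Program Definition comp_functor (C D E : Category)
    (G : Functor D E) (F : Functor C D) : Functor C E :=
  {| fobj := fun X => G (F X); fmor := fun X Y f => fmor G (fmor F f) |}.
Next Obligation. by do 2 apply: fmor_proper. Qed.
Next Obligation.
transitivity (fmor G (idc (F X))); last exact: fmor_id.
by apply: fmor_proper; exact: fmor_id.
Qed.
Next Obligation.
transitivity (fmor G (fmor F g ⊚ fmor F f)); last exact: fmor_comp.
by apply: fmor_proper; exact: fmor_comp.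
Qed.

Program Definition id_nat (C D : Category) (F : Functor C D) : NatTrans F F :=
  {| component := fun X => idc (F X) |}.
Next Obligation. by move=> *; setoid_rewrite comp_idl; setoid_rewrite comp_idr; reflexivity. Qed.

Program Definition comp_nat (C D : Category) (F G H : Functor C D)
    (b : NatTrans G H) (a : NatTrans F G) : NatTrans F H :=
  {| component := fun X => b X ⊚ a X |}.
Next Obligation.
setoid_rewrite comp_assoc; setoid_rewrite naturality.
setoid_rewrite <- comp_assoc; setoid_rewrite naturality.
by setoid_rewrite comp_assoc; reflexivity.
Qed.

Program Definition FunCat (C D : Category) : Category :=
  {| obj := Functor C D; mor := @NatTrans C D;
     mor_eq := fun F G a b => forall X, a X ≈ b X;
     idc := @id_nat C D; comp := @comp_nat C D |}.
Next Obligation.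
split; [by move=> a x; reflexivity | by move=> a b e x; symmetry; exact: e |].
by move=> a b c e e' x; transitivity (b x); [exact: e | exact: e'].
Qed.
Next Obligation. exact: comp_proper. Qed.
Next Obligation. exact: comp_idl. Qed.
Next Obligation. exact: comp_idr. Qed.
Next Obligation. exact: comp_assoc. Qed.

Program Definition precomp (C D E : Category) (K : Functor C D) :
    Functor (FunCat D E) (FunCat C E) :=
  {| fobj := fun F => (comp_functor F K : FunCat C E);
     fmor := fun F G a => {| component := fun X => a (K X) |} |}.
Next Obligation. exact: naturality. Qed.
Next Obligation. by reflexivity. Qed.
Next Obligation. by reflexivity. Qed.

Program Definition FullSub (C : Category) (P : C -> Prop) : Category :=
  {| obj := {X : C | P X};
     mor := fun X Y => mor (sval X) (sval Y);
     mor_eq := fun X Y f g => f ≈ g;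
     idc := fun X => idc (sval X);
     comp := fun X Y Z g f => g ⊚ f |}.
Next Obligation. exact: comp_proper. Qed.
Next Obligation. exact: comp_idl. Qed.
Next Obligation. exact: comp_idr. Qed.
Next Obligation. exact: comp_assoc. Qed.

Program Definition inclusion (C : Category) (P : C -> Prop) :
    Functor (FullSub P) C :=
  {| fobj := fun X => sval X; fmor := fun X Y f => f |}.
Next Obligation. by reflexivity. Qed.
Next Obligation. by reflexivity. Qed.

Program Definition corestrict (C D : Category) (P : D -> Prop)
    (F : Functor C D) (FP : forall X, P (F X)) : Functor C (FullSub P) :=
  {| fobj := fun X => exist P (F X) (FP X); fmor := fun X Y f => fmor F f |}.
Next Obligation. exact: fmor_proper. Qed.
Next Obligation. exact: fmor_id. Qed.
Next Obligation. exact: fmor_comp. Qed.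

Definition is_equivalence (C D : Category) (F : Functor C D) (G : Functor D C)
    : Prop :=
  naturally_isomorphic (comp_functor G F) (id_functor C) /\
  naturally_isomorphic (comp_functor F G) (id_functor D).

(** Categories with families.  [tm_eq] compares terms whose types are equal
    for [ty_eq] but not syntactically the same, as happens in the presence of
    definitional equality; [tm_conv] is the conversion rule. *)
Record CwF := {
  cwf_cat :> Category;
  empty : cwf_cat;
  empty_terminal : is_terminal empty;
  Ty : cwf_cat -> Type;
  ty_eq : forall {Γ}, Ty Γ -> Ty Γ -> Prop;
  ty_eq_equiv : forall Γ, Equivalence (@ty_eq Γ);
  Tm : forall {Γ}, Ty Γ -> Type;
  tm_eq : forall {Γ} {A B : Ty Γ}, Tm A -> Tm B -> Prop;
  tm_eq_ty : forall Γ (A B : Ty Γ) (t : Tm A) (u : Tm B),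
    tm_eq t u -> ty_eq A B;
  tm_eq_refl : forall Γ (A : Ty Γ) (t : Tm A), tm_eq t t;
  tm_eq_sym : forall Γ (A B : Ty Γ) (t : Tm A) (u : Tm B),
    tm_eq t u -> tm_eq u t;
  tm_eq_trans : forall Γ (A B C : Ty Γ) (t : Tm A) (u : Tm B) (v : Tm C),
    tm_eq t u -> tm_eq u v -> tm_eq t v;
  tm_conv : forall Γ (A B : Ty Γ), ty_eq A B ->
    forall t : Tm A, exists u : Tm B, tm_eq t u;
  ty_sub : forall {Γ Δ}, Ty Γ -> mor Δ Γ -> Ty Δ;
  ty_sub_proper : forall Γ Δ (A B : Ty Γ) (γ δ : mor Δ Γ),
    ty_eq A B -> γ ≈ δ -> ty_eq (ty_sub A γ) (ty_sub B δ);
  ty_sub_id : forall Γ (A : Ty Γ), ty_eq (ty_sub A (idc Γ)) A;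
  ty_sub_comp : forall Γ Δ Θ (A : Ty Γ) (γ : mor Δ Γ) (δ : mor Θ Δ),
    ty_eq (ty_sub A (γ ⊚ δ)) (ty_sub (ty_sub A γ) δ);
  tm_sub : forall {Γ Δ} {A : Ty Γ}, Tm A -> forall γ : mor Δ Γ,
    Tm (ty_sub A γ);
  tm_sub_proper : forall Γ Δ (A B : Ty Γ) (t : Tm A) (u : Tm B)
      (γ δ : mor Δ Γ),
    tm_eq t u -> γ ≈ δ -> tm_eq (tm_sub t γ) (tm_sub u δ);
  tm_sub_id : forall Γ (A : Ty Γ) (t : Tm A), tm_eq (tm_sub t (idc Γ)) t;
  tm_sub_comp : forall Γ Δ Θ (A : Ty Γ) (t : Tm A) (γ : mor Δ Γ)
      (δ : mor Θ Δ),
    tm_eq (tm_sub t (γ ⊚ δ)) (tm_sub (tm_sub t γ) δ);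
  extend : forall Γ, Ty Γ -> cwf_cat;
  display : forall {Γ} (A : Ty Γ), mor (extend A) Γ;
  generic : forall {Γ} (A : Ty Γ), Tm (ty_sub A (display A));
  extend_universal : forall Γ (A : Ty Γ) Δ (γ : mor Δ Γ) (t : Tm (ty_sub A γ)),
    exists s : mor Δ (extend A),
      (display A ⊚ s ≈ γ /\ tm_eq (tm_sub (generic A) s) t) /\
      forall s' : mor Δ (extend A), display A ⊚ s' ≈ γ ->
        tm_eq (tm_sub (generic A) s') t -> s' ≈ s }.

Arguments display {c Γ} A.

Definition preserves_terminal (C D : Category) (F : Functor C D) : Prop :=
  forall T : C, is_terminal T -> is_terminal (F T).

Definition preserves_display_pullbacks (C : CwF) (D : Category)
    (F : Functor C D) : Prop :=
  forall (Γ : C) (A : Ty Γ) (Δ P : C) (γ : mor Δ Γ)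
    (a : mor P (extend A)) (b : mor P Δ),
    is_pullback a b (display A) γ ->
    is_pullback (fmor F a) (fmor F b) (fmor F (display A)) (fmor F γ).

Definition is_model (C : CwF) (F : Functor C SetCat) : Prop :=
  preserves_terminal F /\ preserves_display_pullbacks F.

Definition Mod (C : CwF) : Category := @FullSub (FunCat C SetCat) (@is_model C).

Definition is_singleton (T : Type) : Prop := exists x : T, forall y : T, y = x.

(** Variables are de Bruijn levels: [var i] is the i-th variable of the
    context counted from the oldest one, so weakening does not change
    expressions and α-equivalence is equality.  Contexts and substitutions are
    written newest entry first: [A :: Γ] is the extension of [Γ] by a variable
    of type [A], whose level is [size Γ].  In [op Θ A γ] and [coh Θ A γ], the
    context [Θ] binds the variables of [A]. *)

Fixpoint lookup (T : Type) (s : seq T) (i : nat) : option T :=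
  if s is a :: s' then (if i == size s' then Some a else lookup s' i) else None.

Inductive ty : Type :=
| star
| hom (A : ty) (t u : tm)
with tm : Type :=
| var (i : nat)
| op (Θ : seq ty) (A : ty) (γ : seq tm)
| coh (Θ : seq ty) (A : ty) (γ : seq tm).

Notation ctx := (seq ty).
Notation sub := (seq tm).

Fixpoint sub_tm (γ : sub) (t : tm) : tm :=
  match t with
  | var i => odflt (var i) (lookup γ i)
  | op Θ A θ => op Θ A (map (sub_tm γ) θ)
  | coh Θ A θ => coh Θ A (map (sub_tm γ) θ)
  end.

Fixpoint sub_ty (γ : sub) (A : ty) : ty :=
  match A with
  | star => star
  | hom A t u => hom (sub_ty γ A) (sub_tm γ t) (sub_tm γ u)
  end.

Definition sub_comp (γ δ : sub) : sub := map (sub_tm δ) γ.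

(** The identity substitution of a context with [n] variables; it is also the
    projection from any extension of that context. *)
Fixpoint id_sub (n : nat) : sub :=
  if n is m.+1 then var m :: id_sub m else [::].

Fixpoint vars_tm (t : tm) : seq nat :=
  match t with
  | var i => [:: i]
  | op _ _ γ | coh _ _ γ => flatten (map vars_tm γ)
  end.

Fixpoint vars_ty (A : ty) : seq nat :=
  if A is hom A t u then vars_ty A ++ vars_tm t ++ vars_tm u else [::].

Fixpoint dim_ty (A : ty) : nat := if A is hom A _ _ then (dim_ty A).+1 else 0.

Definition dim_ctx (Γ : ctx) : nat := foldr maxn 0 (map dim_ty Γ).

(** [ps_at Γ x A] is the judgment [Γ ⊢ps x : A], for [x] a variable. *)
Inductive ps_at : ctx -> nat -> ty -> Prop :=
| ps_start : ps_at [:: star] 0 star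
| ps_grow Γ x A :
    ps_at Γ x A ->
    ps_at [:: hom A (var x) (var (size Γ)), A & Γ] (size Γ).+1
          (hom A (var x) (var (size Γ)))
| ps_drop Γ f x y A : ps_at Γ f (hom A (var x) (var y)) -> ps_at Γ y A.

Definition ps (Γ : ctx) : Prop := exists x, ps_at Γ x star.

(** The variables of the [i]-dimensional source and target of a ps-context, as
    lists of levels of that ps-context, newest first.  The first two entries
    matched are the types of [f] and [y] in [Γ', y : A, f : Hom A x y]. *)
Fixpoint source_at (i : nat) (Γ : ctx) : seq nat :=
  match Γ with
  | [::] => [::]
  | [:: _] => [:: 0]
  | _ :: A :: Γ' =>
      if i <= dim_ty A then source_at i Γ'
      else [:: (size Γ').+1, size Γ' & source_at i Γ']
  end.

Fixpoint target_at (i : nat) (Γ : ctx) : seq nat :=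
  match Γ with
  | [::] => [::]
  | [:: _] => [:: 0]
  | _ :: A :: Γ' =>
      if i < dim_ty A then target_at i Γ'
      else if i == dim_ty A then size Γ' :: behead (target_at i Γ')
      else [:: (size Γ').+1, size Γ' & target_at i Γ']
  end.

Definition source (Γ : ctx) : seq nat := source_at (dim_ctx Γ).-1 Γ.
Definition target (Γ : ctx) : seq nat := target_at (dim_ctx Γ).-1 Γ.

(** A list [L] of levels of [Γ] stands for a subcontext of [Γ].  With named
    variables nothing has to be done to use an expression of [Γ] in the
    subcontext; with levels, variables are renumbered by their position in
    [L]. *)
Definition renumber (Γ : ctx) (L : seq nat) : sub :=
  [seq var (index l (rev L)) | l <- rev (iota 0 (size Γ))].

Definition subcontext (Γ : ctx) (L : seq nat) : ctx :=
  [seq sub_ty (renumber Γ L) (odflt star (lookup Γ l)) | l <- L].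

(** [op_ty Θ A] and [coh_ty Θ A] say that [A] is a valid operation, resp.
    coherence, type over [Θ].  The condition [0 < dim_ctx Θ] excludes the
    0-disk, which has no boundary. *)
Inductive wf_ctx : ctx -> Prop :=
| wf_nil : wf_ctx [::]
| wf_ext Γ A : wf_ctx Γ -> wf_ty Γ A -> wf_ctx (A :: Γ)

with wf_ty : ctx -> ty -> Prop :=
| wf_star Γ : wf_ctx Γ -> wf_ty Γ star
| wf_hom Γ A t u :
    wf_ty Γ A -> has_ty Γ t A -> has_ty Γ u A -> wf_ty Γ (hom A t u)

with has_ty : ctx -> tm -> ty -> Prop :=
| ty_var Γ i A : wf_ctx Γ -> lookup Γ i = Some A -> has_ty Γ (var i) A
| ty_op Δ Θ A γ :
    op_ty Θ A -> has_sub Δ γ Θ -> has_ty Δ (op Θ A γ) (sub_ty γ A)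
| ty_coh Δ Θ A γ :
    coh_ty Θ A -> has_sub Δ γ Θ -> has_ty Δ (coh Θ A γ) (sub_ty γ A)

with has_sub : ctx -> sub -> ctx -> Prop :=
| sub_nil Δ : wf_ctx Δ -> has_sub Δ [::] [::]
| sub_ext Δ γ Γ A t :
    has_sub Δ γ Γ -> wf_ty Γ A -> has_ty Δ t (sub_ty γ A) ->
    has_sub Δ (t :: γ) (A :: Γ)

with op_ty : ctx -> ty -> Prop :=
| op_ty_intro Θ A t u :
    ps Θ -> 0 < dim_ctx Θ -> wf_ty Θ (hom A t u) ->
    has_ty (subcontext Θ (source Θ))
      (sub_tm (renumber Θ (source Θ)) t) (sub_ty (renumber Θ (source Θ)) A) ->
    has_ty (subcontext Θ (target Θ))
      (sub_tm (renumber Θ (target Θ)) u) (sub_ty (renumber Θ (target Θ)) A) ->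
    vars_tm t ++ vars_ty A =i source Θ ->
    vars_tm u ++ vars_ty A =i target Θ ->
    op_ty Θ (hom A t u)

with coh_ty : ctx -> ty -> Prop :=
| coh_ty_intro Θ A :
    ps Θ -> wf_ty Θ A -> vars_ty A =i iota 0 (size Θ) -> coh_ty Θ A.

Scheme wf_ctx_mut := Minimality for wf_ctx Sort Prop
  with wf_ty_mut := Minimality for wf_ty Sort Prop
  with has_ty_mut := Minimality for has_ty Sort Prop
  with has_sub_mut := Minimality for has_sub Sort Prop
  with op_ty_mut := Minimality for op_ty Sort Prop
  with coh_ty_mut := Minimality for coh_ty Sort Prop.
Combined Scheme catt_mut from
  wf_ctx_mut, wf_ty_mut, has_ty_mut, has_sub_mut, op_ty_mut, coh_ty_mut.

Inductive mty : Type :=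
| munit
| mhom (A : mty) (t u : mtm)
with mtm : Type :=
| mvar (i : nat)
| mtt
| mop (Θ : ctx) (A : ty) (γ : seq mtm)
| mcoh (Θ : ctx) (A : ty) (γ : seq mtm).

Notation mctx := (seq mty).
Notation msub := (seq mtm).

Definition mstar : mty := mhom munit mtt mtt.

Fixpoint msub_tm (γ : msub) (t : mtm) : mtm :=
  match t with
  | mvar i => odflt (mvar i) (lookup γ i)
  | mtt => mtt
  | mop Θ A θ => mop Θ A (map (msub_tm γ) θ)
  | mcoh Θ A θ => mcoh Θ A (map (msub_tm γ) θ)
  end.

Fixpoint msub_ty (γ : msub) (A : mty) : mty :=
  match A with
  | munit => munit
  | mhom A t u => mhom (msub_ty γ A) (msub_tm γ t) (msub_tm γ u)
  end.

Definition msub_comp (γ δ : msub) : msub := map (msub_tm δ) γ.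

Fixpoint mid_sub (n : nat) : msub :=
  if n is m.+1 then mvar m :: mid_sub m else [::].

Fixpoint des_tm (t : tm) : mtm :=
  match t with
  | var i => mvar i
  | op Θ A γ => mop Θ A (map des_tm γ)
  | coh Θ A γ => mcoh Θ A (map des_tm γ)
  end.

Fixpoint des_ty (A : ty) : mty :=
  match A with
  | star => munit
  | hom A t u => mhom (des_ty A) (des_tm t) (des_tm u)
  end.

Definition des_ctx (Γ : ctx) : mctx := map des_ty Γ.
Definition des_sub (γ : sub) : msub := map des_tm γ.

Inductive mwf_ctx : mctx -> Prop :=
| mwf_nil : mwf_ctx [::]
| mwf_ext Γ A : mwf_ctx Γ -> mwf_ty Γ A -> mwf_ctx (A :: Γ)

with mwf_ty : mctx -> mty -> Prop :=
| mwf_unit Γ : mwf_ctx Γ -> mwf_ty Γ munit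
| mwf_hom Γ A t u :
    mwf_ty Γ A -> mhas_ty Γ t A -> mhas_ty Γ u A -> mwf_ty Γ (mhom A t u)

with mhas_ty : mctx -> mtm -> mty -> Prop :=
| mty_var Γ i A : mwf_ctx Γ -> lookup Γ i = Some A -> mhas_ty Γ (mvar i) A
| mty_tt Γ : mwf_ctx Γ -> mhas_ty Γ mtt munit
| mty_op Δ Θ A γ :
    op_ty Θ A -> mhas_sub Δ γ (des_ctx Θ) ->
    mhas_ty Δ (mop Θ A γ) (msub_ty γ (des_ty A))
| mty_coh Δ Θ A γ :
    coh_ty Θ A -> mhas_sub Δ γ (des_ctx Θ) ->
    mhas_ty Δ (mcoh Θ A γ) (msub_ty γ (des_ty A))
| mty_conv Γ t A B : mhas_ty Γ t A -> meq_ty Γ A B -> mhas_ty Γ t B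

with mhas_sub : mctx -> msub -> mctx -> Prop :=
| msub_nil Δ : mwf_ctx Δ -> mhas_sub Δ [::] [::]
| msub_ext Δ γ Γ A t :
    mhas_sub Δ γ Γ -> mwf_ty Γ A -> mhas_ty Δ t (msub_ty γ A) ->
    mhas_sub Δ (t :: γ) (A :: Γ)

with meq_ty : mctx -> mty -> mty -> Prop :=
| meq_ty_refl Γ A : mwf_ty Γ A -> meq_ty Γ A A
| meq_ty_sym Γ A B : meq_ty Γ A B -> meq_ty Γ B A
| meq_ty_trans Γ A B C : meq_ty Γ A B -> meq_ty Γ B C -> meq_ty Γ A C
| meq_hom Γ A B t t' u u' :
    meq_ty Γ A B -> meq_tm Γ t t' A -> meq_tm Γ u u' A ->
    meq_ty Γ (mhom A t u) (mhom B t' u')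

with meq_tm : mctx -> mtm -> mtm -> mty -> Prop :=
| meq_tm_refl Γ t A : mhas_ty Γ t A -> meq_tm Γ t t A
| meq_tm_sym Γ t u A : meq_tm Γ t u A -> meq_tm Γ u t A
| meq_tm_trans Γ t u v A : meq_tm Γ t u A -> meq_tm Γ u v A -> meq_tm Γ t v A
| meq_tm_conv Γ t u A B : meq_tm Γ t u A -> meq_ty Γ A B -> meq_tm Γ t u B
| meq_eta Γ t : mhas_ty Γ t munit -> meq_tm Γ t mtt munit
| meq_op Δ Θ A γ δ :
    op_ty Θ A -> meq_sub Δ γ δ (des_ctx Θ) ->
    meq_tm Δ (mop Θ A γ) (mop Θ A δ) (msub_ty γ (des_ty A))
| meq_coh Δ Θ A γ δ :
    coh_ty Θ A -> meq_sub Δ γ δ (des_ctx Θ) ->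
    meq_tm Δ (mcoh Θ A γ) (mcoh Θ A δ) (msub_ty γ (des_ty A))

with meq_sub : mctx -> msub -> msub -> mctx -> Prop :=
| meq_nil Δ : mwf_ctx Δ -> meq_sub Δ [::] [::] [::]
| meq_ext Δ γ δ Γ A t u :
    meq_sub Δ γ δ Γ -> mwf_ty Γ A -> meq_tm Δ t u (msub_ty γ A) ->
    meq_sub Δ (t :: γ) (u :: δ) (A :: Γ).

Scheme mwf_ctx_mut := Minimality for mwf_ctx Sort Prop
  with mwf_ty_mut := Minimality for mwf_ty Sort Prop
  with mhas_ty_mut := Minimality for mhas_ty Sort Prop
  with mhas_sub_mut := Minimality for mhas_sub Sort Prop
  with meq_ty_mut := Minimality for meq_ty Sort Prop
  with meq_tm_mut := Minimality for meq_tm Sort Prop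
  with meq_sub_mut := Minimality for meq_sub Sort Prop.
Combined Scheme mcatt_mut from mwf_ctx_mut, mwf_ty_mut, mhas_ty_mut,
  mhas_sub_mut, meq_ty_mut, meq_tm_mut, meq_sub_mut.

(** The fresh variable [•] is the oldest one of the suspended context, [var 0].
    Dropping the variables of type [munit] shifts the levels of the others. *)

Definition nonunit (A : mty) : bool := if A is munit then false else true.

Fixpoint sus_vars (Γ : mctx) : sub :=
  if Γ is A :: Γ' then
    (if nonunit A then var (count nonunit Γ').+1 else var 0) :: sus_vars Γ'
  else [::].

(** [•_Θ] sends the variables of [Θ] of type [star], which are those of type
    [munit] in its desuspension, to [•] and the others to themselves. *)
Definition bullet (Θ : ctx) : sub := sus_vars (des_ctx Θ).

(** The suspension of a substitution into [Γ], from the list of the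
    suspensions of all its entries. *)
Definition sus_entries (Γ : mctx) (s : sub) : sub :=
  rcons (mask (map nonunit Γ) s) (var 0).

(** Here [ρ] is [sus_vars Γ] for [Γ] the ambient context. *)
Fixpoint sus_tm (ρ : sub) (t : mtm) : tm :=
  match t with
  | mvar i => odflt (var 0) (lookup ρ i)
  | mtt => var 0
  | mop Θ A γ =>
      op Θ A (sub_comp (bullet Θ) (sus_entries (des_ctx Θ) (map (sus_tm ρ) γ)))
  | mcoh Θ A γ =>
      coh Θ A (sub_comp (bullet Θ) (sus_entries (des_ctx Θ) (map (sus_tm ρ) γ)))
  end.

Fixpoint sus_ty (ρ : sub) (A : mty) : ty :=
  match A with
  | munit => star
  | mhom A t u => hom (sus_ty ρ A) (sus_tm ρ t) (sus_tm ρ u)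
  end.

Fixpoint sus_ctx (Γ : mctx) : ctx :=
  if Γ is A :: Γ' then
    if nonunit A then sus_ty (sus_vars Γ') A :: sus_ctx Γ' else sus_ctx Γ'
  else [:: star].

(** The suspension of [γ : Δ -> Γ]. *)
Definition sus_sub (Δ Γ : mctx) (γ : msub) : sub :=
  sus_entries Γ (map (sus_tm (sus_vars Δ)) γ).

Section TyTmInd.
Variables (P : ty -> Prop) (Q : tm -> Prop).
Hypothesis Pstar : P star.
Hypothesis Phom : forall A t u, P A -> Q t -> Q u -> P (hom A t u).
Hypothesis Qvar : forall i, Q (var i).
Hypothesis Qop : forall Θ A γ, List.Forall Q γ -> Q (op Θ A γ).
Hypothesis Qcoh : forall Θ A γ, List.Forall Q γ -> Q (coh Θ A γ).

Fixpoint tm_nested (t : tm) : Q t :=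
  let fix go (γ : sub) : List.Forall Q γ :=
    match γ with
    | [::] => List.Forall_nil Q
    | t :: γ => List.Forall_cons t (tm_nested t) (go γ)
    end in
  match t with
  | var i => Qvar i
  | op Θ A γ => Qop Θ A (go γ)
  | coh Θ A γ => Qcoh Θ A (go γ)
  end.

Fixpoint ty_nested (A : ty) : P A :=
  match A with
  | star => Pstar
  | hom A t u => Phom (ty_nested A) (tm_nested t) (tm_nested u)
  end.

Lemma ty_tm_ind : (forall A, P A) /\ (forall t, Q t).
Proof. exact: (conj ty_nested tm_nested). Qed.
End TyTmInd.

Section MTyTmInd.
Variables (P : mty -> Prop) (Q : mtm -> Prop).
Hypothesis Punit : P munit.
Hypothesis Phom : forall A t u, P A -> Q t -> Q u -> P (mhom A t u).
Hypothesis Qvar : forall i, Q (mvar i).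
Hypothesis Qtt : Q mtt.
Hypothesis Qop : forall Θ A γ, List.Forall Q γ -> Q (mop Θ A γ).
Hypothesis Qcoh : forall Θ A γ, List.Forall Q γ -> Q (mcoh Θ A γ).

Fixpoint mtm_nested (t : mtm) : Q t :=
  let fix go (γ : msub) : List.Forall Q γ :=
    match γ with
    | [::] => List.Forall_nil Q
    | t :: γ => List.Forall_cons t (mtm_nested t) (go γ)
    end in
  match t with
  | mvar i => Qvar i
  | mtt => Qtt
  | mop Θ A γ => Qop Θ A (go γ)
  | mcoh Θ A γ => Qcoh Θ A (go γ)
  end.

Fixpoint mty_nested (A : mty) : P A :=
  match A with
  | munit => Punit
  | mhom A t u => Phom (mty_nested A) (mtm_nested t) (mtm_nested u)
  end.

Lemma mty_tm_ind : (forall A, P A) /\ (forall t, Q t).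
Proof. exact: (conj mty_nested mtm_nested). Qed.
End MTyTmInd.

Lemma Forall_map_eq (T U : Type) (f g : T -> U) (s : seq T) :
  List.Forall (fun x => f x = g x) s -> map f s = map g s.
Proof. by elim=> //= x s' -> _ ->. Qed.

Lemma lookup_lt (T : Type) (s : seq T) i a : lookup s i = Some a -> i < size s.
Proof.
elim: s => //= b s IH; case: eqP => [-> //|_ /IH]; exact: ltnW.
Qed.

Lemma lookup_some (T : Type) (s : seq T) i :
  i < size s -> exists a, lookup s i = Some a.
Proof.
elim: s => //= b s IH; rewrite ltnS leq_eqVlt.
by case: eqP => [_ _ | _ /=]; [exists b | exact: IH].
Qed.

Lemma lookup_cons_lt (T : Type) (s : seq T) a i :
  i < size s -> lookup (a :: s) i = lookup s i.
Proof. by move=> /= lt; rewrite ltn_eqF. Qed.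

Lemma lookup_map (T U : Type) (f : T -> U) s i :
  lookup (map f s) i = omap f (lookup s i).
Proof. by elim: s => //= a s IH; rewrite size_map; case: eqP. Qed.

Definition below (n : nat) (s : seq nat) : bool := all (fun i => i < n) s.

Lemma below_flatten n (ss : seq (seq nat)) :
  below n (flatten ss) = all (below n) ss.
Proof. by elim: ss => //= s ss <-; rewrite /below all_cat. Qed.

Lemma below_cat n s t : below n (s ++ t) = below n s && below n t.
Proof. exact: all_cat. Qed.

Lemma below_le n m s : n <= m -> below n s -> below m s.
Proof. by move=> le; apply: sub_all => i lt; apply: leq_trans le. Qed.

Definition closed_sub (n : nat) (γ : sub) : bool :=
  all (fun t => below n (vars_tm t)) γ.

Lemma all_map_flatten n (γ : sub) :
  below n (flatten (map vars_tm γ)) = closed_sub n γ.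
Proof. by rewrite below_flatten all_map. Qed.

Lemma sub_agree (γ δ : sub) :
  (forall A, {in vars_ty A, forall i, sub_tm γ (var i) = sub_tm δ (var i)} ->
     sub_ty γ A = sub_ty δ A) /\
  (forall t, {in vars_tm t, forall i, sub_tm γ (var i) = sub_tm δ (var i)} ->
     sub_tm γ t = sub_tm δ t).
Proof.
have aux : forall s,
    List.Forall (fun t =>
      {in vars_tm t, forall i, sub_tm γ (var i) = sub_tm δ (var i)} ->
      sub_tm γ t = sub_tm δ t) s ->
    {in flatten (map vars_tm s),
      forall i, sub_tm γ (var i) = sub_tm δ (var i)} ->
    map (sub_tm γ) s = map (sub_tm δ) s.
  move=> s; elim=> //= t s' IHt _ IHs H.
  rewrite IHt => [|i i_t]; last by apply: H; rewrite mem_cat i_t.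
  by rewrite IHs // => i i_s; apply: H; rewrite mem_cat i_s orbT.
apply: ty_tm_ind => //=.
- move=> A t u IHA IHt IHu H.
  rewrite IHA ?IHt ?IHu // => i i_in; apply: H;
    by rewrite !mem_cat i_in ?orbT.
- by move=> i; apply; rewrite inE.
- by move=> Θ A s IH H; rewrite (aux _ IH H).
- by move=> Θ A s IH H; rewrite (aux _ IH H).
Qed.

Lemma sub_ty_cons t (γ : sub) A :
  below (size γ) (vars_ty A) -> sub_ty (t :: γ) A = sub_ty γ A.
Proof.
move=> /allP cl; apply: (sub_agree _ _).1 => i /cl lt.
by rewrite /sub_tm lookup_cons_lt.
Qed.

Lemma sub_tm_cons t (γ : sub) u :
  below (size γ) (vars_tm u) -> sub_tm (t :: γ) u = sub_tm γ u.
Proof.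
move=> /allP cl; apply: (sub_agree _ _).2 => i /cl lt.
by rewrite /sub_tm lookup_cons_lt.
Qed.

Lemma size_id_sub n : size (id_sub n) = n.
Proof. by elim: n => //= n ->. Qed.

Lemma lookup_id_sub n i : lookup (id_sub n) i = if i < n then Some (var i) else None.
Proof.
elim: n => //= n IH; rewrite size_id_sub IH ltnS.
by case: ltngtP => [||->].
Qed.

Lemma sub_id n : (forall A, sub_ty (id_sub n) A = A) /\
  (forall t, sub_tm (id_sub n) t = t).
Proof.
have aux s : List.Forall (fun t => sub_tm (id_sub n) t = t) s ->
    map (sub_tm (id_sub n)) s = s.
  by move=> /Forall_map_eq ->; rewrite map_id.
apply: ty_tm_ind => //=.
- by move=> A t u -> -> ->.
- by move=> i; rewrite lookup_id_sub; case: ifP.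
- by move=> Θ A s /aux ->.
- by move=> Θ A s /aux ->.
Qed.

Lemma sub_comp_idr (γ : sub) n : sub_comp γ (id_sub n) = γ.
Proof. by rewrite /sub_comp (eq_map (sub_id n).2) map_id. Qed.

Lemma sub_sub (γ δ : sub) :
  (forall A, below (size γ) (vars_ty A) ->
     sub_ty δ (sub_ty γ A) = sub_ty (sub_comp γ δ) A) /\
  (forall t, below (size γ) (vars_tm t) ->
     sub_tm δ (sub_tm γ t) = sub_tm (sub_comp γ δ) t).
Proof.
have aux s : List.Forall (fun t => below (size γ) (vars_tm t) ->
      sub_tm δ (sub_tm γ t) = sub_tm (sub_comp γ δ) t) s ->
    below (size γ) (flatten (map vars_tm s)) ->
    map (sub_tm δ) (map (sub_tm γ) s) = map (sub_tm (sub_comp γ δ)) s.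
  by elim=> //= t s' IHt _ IHs; rewrite below_cat => /andP[/IHt -> /IHs ->].
apply: ty_tm_ind => //=.
- move=> A t u IHA IHt IHu; rewrite !below_cat => /and3P[cA ct cu].
  by rewrite IHA ?IHt ?IHu.
- move=> i /andP[lt _]; rewrite lookup_map.
  by case: (lookup_some lt) => t ->.
- by move=> Θ A s IH cl; rewrite aux.
- by move=> Θ A s IH cl; rewrite aux.
Qed.

Lemma sub_comp_assoc (θ γ δ : sub) :
  closed_sub (size γ) θ ->
  sub_comp (sub_comp θ γ) δ = sub_comp θ (sub_comp γ δ).
Proof.
rewrite /sub_comp -map_comp; elim: θ => //= t θ IH /andP[ct /IH ->].
by rewrite (sub_sub _ _).2.
Qed.

Lemma sub_comp_cons t (γ θ : sub) :
  closed_sub (size γ) θ -> sub_comp θ (t :: γ) = sub_comp θ γ.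
Proof.
by rewrite /sub_comp; elim: θ => //= u θ IH /andP[cu /IH ->]; rewrite sub_tm_cons.
Qed.

Lemma closed_id_sub n : closed_sub n (id_sub n).
Proof.
elim: n => //= n IH; rewrite ltnSn /=.
by apply: sub_all IH => t; apply: below_le.
Qed.

Lemma sub_comp_idl (γ : sub) : sub_comp (id_sub (size γ)) γ = γ.
Proof.
elim: γ => //= t γ IH; rewrite eqxx /=; congr (_ :: _).
by rewrite -[RHS]IH; apply: sub_comp_cons; apply: closed_id_sub.
Qed.

Lemma catt_scoped :
  (forall Γ, wf_ctx Γ ->
     forall i A, lookup Γ i = Some A -> below i (vars_ty A)) /\
  (forall Γ A, wf_ty Γ A -> below (size Γ) (vars_ty A)) /\
  (forall Γ t A, has_ty Γ t A -> below (size Γ) (vars_tm t)) /\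
  (forall Δ γ Γ, has_sub Δ γ Γ -> closed_sub (size Δ) γ /\ size γ = size Γ) /\
  (forall Θ A, op_ty Θ A -> below (size Θ) (vars_ty A)) /\
  (forall Θ A, coh_ty Θ A -> below (size Θ) (vars_ty A)).
Proof.
apply: catt_mut => //=.
- move=> Γ A _ IH _ cA i B; case: eqP => [-> [<-] //|_]; exact: IH.
- by move=> Γ A t u _ cA _ ct _ cu; rewrite !below_cat cA ct.
- by move=> Γ i A _ _ lk; rewrite /below /= (lookup_lt lk).
- by move=> Δ Θ A γ _ _ _ [? _]; rewrite all_map_flatten.
- by move=> Δ Θ A γ _ _ _ [? _]; rewrite all_map_flatten.
- by move=> Δ γ Γ A t _ [? ->] _ _ _ ->.
Qed.

Lemma wf_ctx_scoped Γ i A :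
  wf_ctx Γ -> lookup Γ i = Some A -> below i (vars_ty A).
Proof. by move=> /(catt_scoped.1); apply. Qed.

Lemma wf_ty_scoped Γ A : wf_ty Γ A -> below (size Γ) (vars_ty A).
Proof. exact: catt_scoped.2.1. Qed.

Lemma has_ty_scoped Γ t A : has_ty Γ t A -> below (size Γ) (vars_tm t).
Proof. exact: catt_scoped.2.2.1. Qed.

Lemma has_sub_scoped Δ γ Γ : has_sub Δ γ Γ -> closed_sub (size Δ) γ.
Proof. by case/catt_scoped.2.2.2.1. Qed.

Lemma has_sub_size Δ γ Γ : has_sub Δ γ Γ -> size γ = size Γ.
Proof. by case/catt_scoped.2.2.2.1. Qed.

Lemma catt_presup :
  (forall Γ, wf_ctx Γ -> True) /\
  (forall Γ A, wf_ty Γ A -> wf_ctx Γ) /\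
  (forall Γ t A, has_ty Γ t A -> wf_ctx Γ) /\
  (forall Δ γ Γ, has_sub Δ γ Γ -> wf_ctx Δ /\ wf_ctx Γ) /\
  (forall Θ A, op_ty Θ A -> wf_ty Θ A) /\
  (forall Θ A, coh_ty Θ A -> wf_ty Θ A).
Proof.
apply: catt_mut => //=.
- by move=> Δ Θ A γ _ _ _ [].
- by move=> Δ Θ A γ _ _ _ [].
- by move=> *; split=> //; exact: wf_nil.
- by move=> Δ γ Γ A t _ [? ?] *; split=> //; exact: wf_ext.
Qed.

Lemma wf_ty_ctx Γ A : wf_ty Γ A -> wf_ctx Γ.
Proof. exact: catt_presup.2.1. Qed.

Lemma op_ty_wf Θ A : op_ty Θ A -> wf_ty Θ A.
Proof. exact: catt_presup.2.2.2.2.1. Qed.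

Lemma coh_ty_wf Θ A : coh_ty Θ A -> wf_ty Θ A.
Proof. exact: catt_presup.2.2.2.2.2. Qed.

Lemma op_ty_neq_star Θ A : op_ty Θ A -> A <> star.
Proof. by case. Qed.

Lemma ps_size Θ : ps Θ -> 0 < size Θ.
Proof. by case=> x; elim. Qed.

Lemma coh_ty_neq_star Θ A : coh_ty Θ A -> A <> star.
Proof.
case=> Θ' A' /ps_size Θ0 _ e A'0; move: (e 0).
by rewrite A'0 mem_iota Θ0 in_nil.
Qed.

Lemma catt_weaken :
  (forall Γ, wf_ctx Γ -> True) /\
  (forall Γ A, wf_ty Γ A -> forall B, wf_ctx (B :: Γ) -> wf_ty (B :: Γ) A) /\
  (forall Γ t A, has_ty Γ t A ->
     forall B, wf_ctx (B :: Γ) -> has_ty (B :: Γ) t A) /\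
  (forall Δ γ Γ, has_sub Δ γ Γ ->
     forall B, wf_ctx (B :: Δ) -> has_sub (B :: Δ) γ Γ) /\
  (forall Θ A, op_ty Θ A -> True) /\
  (forall Θ A, coh_ty Θ A -> True).
Proof.
apply: catt_mut => //.
- by move=> Γ *; exact: wf_star.
- by move=> Γ A t u _ IHA _ IHt _ IHu B wB; apply: wf_hom; auto.
- move=> Γ i A _ _ lk B wB; apply: ty_var => //.
  by rewrite lookup_cons_lt // (lookup_lt lk).
- by move=> Δ Θ A γ oA _ _ IH B wB; apply: ty_op => //; exact: IH.
- by move=> Δ Θ A γ oA _ _ IH B wB; apply: ty_coh => //; exact: IH.
- by move=> *; exact: sub_nil.
- by move=> Δ γ Γ A t _ IH wA _ _ IHt B wB; apply: sub_ext; auto.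
Qed.

Lemma wf_ty_weaken Γ A B : wf_ctx (B :: Γ) -> wf_ty Γ A -> wf_ty (B :: Γ) A.
Proof. by move=> w /catt_weaken.2.1; apply. Qed.

Lemma has_ty_weaken Γ t A B :
  wf_ctx (B :: Γ) -> has_ty Γ t A -> has_ty (B :: Γ) t A.
Proof. by move=> w /catt_weaken.2.2.1; apply. Qed.

Lemma has_sub_weaken Δ γ Γ B :
  wf_ctx (B :: Δ) -> has_sub Δ γ Γ -> has_sub (B :: Δ) γ Γ.
Proof. by move=> w /catt_weaken.2.2.2.1; apply. Qed.

Lemma has_sub_lookup Δ γ Γ i A :
  has_sub Δ γ Γ -> lookup Γ i = Some A ->
  has_ty Δ (sub_tm γ (var i)) (sub_ty γ A).
Proof.
elim=> // {}Δ {}γ {}Γ B t hγ IH wB ht lk.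
have /= sz := has_sub_size hγ.
have wG : wf_ctx (B :: Γ) by apply: wf_ext => //; exact: wf_ty_ctx wB.
have := wf_ctx_scoped wG lk.
have := lookup_lt lk; rewrite /= ltnS => le /(below_le le); rewrite -sz => cA.
rewrite sub_ty_cons //.
move: lk => /=; rewrite sz; case: eqP => [_ [<-] //| _ /IH].
by rewrite /= .
Qed.

Lemma catt_subst :
  (forall Γ, wf_ctx Γ -> True) /\
  (forall Γ A, wf_ty Γ A ->
     forall Δ γ, has_sub Δ γ Γ -> wf_ty Δ (sub_ty γ A)) /\
  (forall Γ t A, has_ty Γ t A ->
     forall Δ γ, has_sub Δ γ Γ -> has_ty Δ (sub_tm γ t) (sub_ty γ A)) /\
  (forall Γ θ Θ, has_sub Γ θ Θ ->
     forall Δ γ, has_sub Δ γ Γ -> has_sub Δ (sub_comp θ γ) Θ) /\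
  (forall Θ A, op_ty Θ A -> True) /\
  (forall Θ A, coh_ty Θ A -> True).
Proof.
apply: catt_mut => //.
- by move=> Γ _ _ Δ γ /catt_presup.2.2.2.1 [w _]; exact: wf_star.
- by move=> Γ A t u _ IHA _ IHt _ IHu Δ γ hγ; apply: wf_hom; auto.
- by move=> Γ i A _ _ lk Δ γ hγ; exact: has_sub_lookup lk.
- move=> Γ Θ A θ oA _ hθ IH Δ γ hγ.
  rewrite (sub_sub _ _).1; last first.
    by rewrite (has_sub_size hθ); apply: wf_ty_scoped (op_ty_wf oA).
  by apply: ty_op => //; exact: IH.
- move=> Γ Θ A θ oA _ hθ IH Δ γ hγ.
  rewrite (sub_sub _ _).1; last first.
    by rewrite (has_sub_size hθ); apply: wf_ty_scoped (coh_ty_wf oA).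
  by apply: ty_coh => //; exact: IH.
- by move=> Γ _ _ Δ γ /catt_presup.2.2.2.1 [w _]; exact: sub_nil.
- move=> Γ θ Θ A t hθ IH wA _ _ IHt Δ γ hγ; apply: sub_ext => //.
    exact: IH.
  rewrite -(sub_sub _ _).1; first exact: IHt.
  by rewrite (has_sub_size hθ); exact: wf_ty_scoped wA.
Qed.

Lemma wf_ty_sub Γ A Δ γ : has_sub Δ γ Γ -> wf_ty Γ A -> wf_ty Δ (sub_ty γ A).
Proof. by move=> h /catt_subst.2.1; apply. Qed.

Lemma has_ty_sub Γ t A Δ γ :
  has_sub Δ γ Γ -> has_ty Γ t A -> has_ty Δ (sub_tm γ t) (sub_ty γ A).
Proof. by move=> h /catt_subst.2.2.1; apply. Qed.

Lemma has_sub_comp Γ θ Θ Δ γ :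
  has_sub Γ θ Θ -> has_sub Δ γ Γ -> has_sub Δ (sub_comp θ γ) Θ.
Proof. by move=> /catt_subst.2.2.2.1 h; apply: h. Qed.

Lemma has_sub_id Γ : wf_ctx Γ -> has_sub Γ (id_sub (size Γ)) Γ.
Proof.
elim: Γ => [|A Γ IH] w; first exact: sub_nil.
inversion_clear w as [|? ? wΓ wA].
have w' : wf_ctx (A :: Γ) by exact: wf_ext.
apply: sub_ext => //; first by apply: has_sub_weaken => //; exact: IH.
by rewrite (sub_id _).1; apply: ty_var => //=; rewrite eqxx.
Qed.

Lemma has_sub_proj Γ A : wf_ty Γ A -> has_sub (A :: Γ) (id_sub (size Γ)) Γ.
Proof.
move=> wA; have wΓ := wf_ty_ctx wA.
by apply: has_sub_weaken (has_sub_id wΓ); exact: wf_ext.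
Qed.

Lemma has_sub_compA Γ θ Θ Δ γ Ξ δ :
  has_sub Γ θ Θ -> has_sub Δ γ Γ -> has_sub Ξ δ Δ ->
  sub_comp (sub_comp θ γ) δ = sub_comp θ (sub_comp γ δ).
Proof.
move=> hθ hγ hδ; apply: sub_comp_assoc.
by rewrite (has_sub_size hγ); exact: has_sub_scoped hθ.
Qed.

Lemma has_sub_idl Δ γ Γ : has_sub Δ γ Γ -> sub_comp (id_sub (size Γ)) γ = γ.
Proof. by move=> /has_sub_size <-; exact: sub_comp_idl. Qed.

Lemma has_sub_cons_inv Δ γ A Γ : has_sub Δ γ (A :: Γ) ->
  exists t γ', [/\ γ = t :: γ', has_sub Δ γ' Γ & has_ty Δ t (sub_ty γ' A)].
Proof. by move=> h; inversion_clear h; do 2 eexists; split. Qed.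

Fixpoint mvars_tm (t : mtm) : seq nat :=
  match t with
  | mvar i => [:: i]
  | mtt => [::]
  | mop _ _ γ | mcoh _ _ γ => flatten (map mvars_tm γ)
  end.

Fixpoint mvars_ty (A : mty) : seq nat :=
  if A is mhom A t u then mvars_ty A ++ mvars_tm t ++ mvars_tm u else [::].

Definition mclosed_sub (n : nat) (γ : msub) : bool :=
  all (fun t => below n (mvars_tm t)) γ.

Lemma mall_map_flatten n (γ : msub) :
  below n (flatten (map mvars_tm γ)) = mclosed_sub n γ.
Proof. by rewrite below_flatten all_map. Qed.

Lemma msub_agree (γ δ : msub) :
  (forall A, {in mvars_ty A, forall i, msub_tm γ (mvar i) = msub_tm δ (mvar i)} ->
     msub_ty γ A = msub_ty δ A) /\
  (forall t, {in mvars_tm t, forall i, msub_tm γ (mvar i) = msub_tm δ (mvar i)} ->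
     msub_tm γ t = msub_tm δ t).
Proof.
have aux : forall s,
    List.Forall (fun t =>
      {in mvars_tm t, forall i, msub_tm γ (mvar i) = msub_tm δ (mvar i)} ->
      msub_tm γ t = msub_tm δ t) s ->
    {in flatten (map mvars_tm s),
      forall i, msub_tm γ (mvar i) = msub_tm δ (mvar i)} ->
    map (msub_tm γ) s = map (msub_tm δ) s.
  move=> s; elim=> //= t s' IHt _ IHs H.
  rewrite IHt => [|i i_t]; last by apply: H; rewrite mem_cat i_t.
  by rewrite IHs // => i i_s; apply: H; rewrite mem_cat i_s orbT.
apply: mty_tm_ind => //=.
- move=> A t u IHA IHt IHu H.
  rewrite IHA ?IHt ?IHu // => i i_in; apply: H;
    by rewrite !mem_cat i_in ?orbT.
- by move=> i; apply; rewrite inE.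
- by move=> Θ A s IH H; rewrite (aux _ IH H).
- by move=> Θ A s IH H; rewrite (aux _ IH H).
Qed.

Lemma msub_ty_cons t (γ : msub) A :
  below (size γ) (mvars_ty A) -> msub_ty (t :: γ) A = msub_ty γ A.
Proof.
move=> /allP cl; apply: (msub_agree _ _).1 => i /cl lt.
by rewrite /msub_tm lookup_cons_lt.
Qed.

Lemma msub_tm_cons t (γ : msub) u :
  below (size γ) (mvars_tm u) -> msub_tm (t :: γ) u = msub_tm γ u.
Proof.
move=> /allP cl; apply: (msub_agree _ _).2 => i /cl lt.
by rewrite /msub_tm lookup_cons_lt.
Qed.

Lemma size_mid_sub n : size (mid_sub n) = n.
Proof. by elim: n => //= n ->. Qed.

Lemma lookup_mid_sub n i :
  lookup (mid_sub n) i = if i < n then Some (mvar i) else None.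
Proof.
elim: n => //= n IH; rewrite size_mid_sub IH ltnS.
by case: ltngtP => [||->].
Qed.

Lemma msub_id n : (forall A, msub_ty (mid_sub n) A = A) /\
  (forall t, msub_tm (mid_sub n) t = t).
Proof.
have aux s : List.Forall (fun t => msub_tm (mid_sub n) t = t) s ->
    map (msub_tm (mid_sub n)) s = s.
  by move=> /Forall_map_eq ->; rewrite map_id.
apply: mty_tm_ind => //=.
- by move=> A t u -> -> ->.
- by move=> i; rewrite lookup_mid_sub; case: ifP.
- by move=> Θ A s /aux ->.
- by move=> Θ A s /aux ->.
Qed.

Lemma msub_comp_idr (γ : msub) n : msub_comp γ (mid_sub n) = γ.
Proof. by rewrite /msub_comp (eq_map (msub_id n).2) map_id. Qed.

Lemma msub_sub (γ δ : msub) :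
  (forall A, below (size γ) (mvars_ty A) ->
     msub_ty δ (msub_ty γ A) = msub_ty (msub_comp γ δ) A) /\
  (forall t, below (size γ) (mvars_tm t) ->
     msub_tm δ (msub_tm γ t) = msub_tm (msub_comp γ δ) t).
Proof.
have aux s : List.Forall (fun t => below (size γ) (mvars_tm t) ->
      msub_tm δ (msub_tm γ t) = msub_tm (msub_comp γ δ) t) s ->
    below (size γ) (flatten (map mvars_tm s)) ->
    map (msub_tm δ) (map (msub_tm γ) s) = map (msub_tm (msub_comp γ δ)) s.
  by elim=> //= t s' IHt _ IHs; rewrite below_cat => /andP[/IHt -> /IHs ->].
apply: mty_tm_ind => //=.
- move=> A t u IHA IHt IHu; rewrite !below_cat => /and3P[cA ct cu].
  by rewrite IHA ?IHt ?IHu.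
- move=> i /andP[lt _]; rewrite lookup_map.
  by case: (lookup_some lt) => t ->.
- by move=> Θ A s IH cl; rewrite aux.
- by move=> Θ A s IH cl; rewrite aux.
Qed.

Lemma msub_comp_assoc (θ γ δ : msub) :
  mclosed_sub (size γ) θ ->
  msub_comp (msub_comp θ γ) δ = msub_comp θ (msub_comp γ δ).
Proof.
rewrite /msub_comp -map_comp; elim: θ => //= t θ IH /andP[ct /IH ->].
by rewrite (msub_sub _ _).2.
Qed.

Lemma msub_comp_cons t (γ θ : msub) :
  mclosed_sub (size γ) θ -> msub_comp θ (t :: γ) = msub_comp θ γ.
Proof.
by rewrite /msub_comp; elim: θ => //= u θ IH /andP[cu /IH ->];
  rewrite msub_tm_cons.
Qed.

Lemma mclosed_mid_sub n : mclosed_sub n (mid_sub n).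
Proof.
elim: n => //= n IH; rewrite ltnSn /=.
by apply: sub_all IH => t; apply: below_le.
Qed.

Lemma msub_comp_idl (γ : msub) : msub_comp (mid_sub (size γ)) γ = γ.
Proof.
elim: γ => //= t γ IH; rewrite eqxx /=; congr (_ :: _).
by rewrite -[RHS]IH; apply: msub_comp_cons; apply: mclosed_mid_sub.
Qed.

Lemma des_sub_raw (γ : sub) :
  (forall A, des_ty (sub_ty γ A) = msub_ty (des_sub γ) (des_ty A)) /\
  (forall t, des_tm (sub_tm γ t) = msub_tm (des_sub γ) (des_tm t)).
Proof.
have aux s : List.Forall (fun t =>
      des_tm (sub_tm γ t) = msub_tm (des_sub γ) (des_tm t)) s ->
    map des_tm (map (sub_tm γ) s) = map (msub_tm (des_sub γ)) (map des_tm s).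
  by rewrite -!map_comp; apply: Forall_map_eq.
apply: ty_tm_ind => //=.
- by move=> A t u -> -> ->.
- by move=> i; rewrite lookup_map; case: lookup.
- by move=> Θ A s /aux ->.
- by move=> Θ A s /aux ->.
Qed.

Lemma mvars_des :
  (forall A, mvars_ty (des_ty A) = vars_ty A) /\
  (forall t, mvars_tm (des_tm t) = vars_tm t).
Proof.
apply: ty_tm_ind => //=.
- by move=> A t u -> -> ->.
- by move=> Θ A s /Forall_map_eq <-; rewrite -map_comp.
- by move=> Θ A s /Forall_map_eq <-; rewrite -map_comp.
Qed.

Lemma size_des_ctx Γ : size (des_ctx Γ) = size Γ.
Proof. exact: size_map. Qed.

Lemma des_typed :
  (forall Γ, wf_ctx Γ -> mwf_ctx (des_ctx Γ)) /\
  (forall Γ A, wf_ty Γ A -> mwf_ty (des_ctx Γ) (des_ty A)) /\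
  (forall Γ t A, has_ty Γ t A -> mhas_ty (des_ctx Γ) (des_tm t) (des_ty A)) /\
  (forall Δ γ Γ, has_sub Δ γ Γ ->
     mhas_sub (des_ctx Δ) (des_sub γ) (des_ctx Γ)) /\
  (forall Θ A, op_ty Θ A -> True) /\
  (forall Θ A, coh_ty Θ A -> True).
Proof.
apply: catt_mut => //=.
- exact: mwf_nil.
- by move=> Γ A _ ? _ ?; exact: mwf_ext.
- by move=> *; exact: mwf_unit.
- by move=> *; exact: mwf_hom.
- by move=> Γ i A _ ? lk; apply: mty_var => //; rewrite lookup_map lk.
- by move=> Δ Θ A γ oA _ _ IH; rewrite (des_sub_raw γ).1; apply: mty_op.
- by move=> Δ Θ A γ oA _ _ IH; rewrite (des_sub_raw γ).1; apply: mty_coh.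
- by move=> *; exact: msub_nil.
- move=> Δ γ Γ A t _ IH _ wA _; rewrite (des_sub_raw γ).1 => ht.
  exact: msub_ext.
Qed.

Lemma des_wf_ctx Γ : wf_ctx Γ -> mwf_ctx (des_ctx Γ).
Proof. exact: des_typed.1. Qed.

Lemma des_wf_ty Γ A : wf_ty Γ A -> mwf_ty (des_ctx Γ) (des_ty A).
Proof. exact: des_typed.2.1. Qed.

Lemma des_has_ty Γ t A :
  has_ty Γ t A -> mhas_ty (des_ctx Γ) (des_tm t) (des_ty A).
Proof. exact: des_typed.2.2.1. Qed.

Lemma des_has_sub Δ γ Γ :
  has_sub Δ γ Γ -> mhas_sub (des_ctx Δ) (des_sub γ) (des_ctx Γ).
Proof. exact: des_typed.2.2.2.1. Qed.

Lemma mcatt_scoped :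
  (forall Γ, mwf_ctx Γ ->
     forall i A, lookup Γ i = Some A -> below i (mvars_ty A)) /\
  (forall Γ A, mwf_ty Γ A -> below (size Γ) (mvars_ty A)) /\
  (forall Γ t A, mhas_ty Γ t A -> below (size Γ) (mvars_tm t)) /\
  (forall Δ γ Γ, mhas_sub Δ γ Γ -> mclosed_sub (size Δ) γ /\ size γ = size Γ) /\
  (forall Γ A B, meq_ty Γ A B -> True) /\
  (forall Γ t u A, meq_tm Γ t u A -> True) /\
  (forall Δ γ δ Γ, meq_sub Δ γ δ Γ -> size γ = size Γ /\ size δ = size Γ).
Proof.
apply: mcatt_mut => //=.
- move=> Γ A _ IH _ cA i B; case: eqP => [-> [<-] //|_]; exact: IH.
- by move=> Γ A t u _ cA _ ct _ cu; rewrite !below_cat cA ct.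
- by move=> Γ i A _ _ lk; rewrite /below /= (lookup_lt lk).
- by move=> Δ Θ A γ _ _ [? _]; rewrite mall_map_flatten.
- by move=> Δ Θ A γ _ _ [? _]; rewrite mall_map_flatten.
- by move=> Δ γ Γ A t _ [? ->] _ _ _ ->.
- by move=> Δ γ δ Γ A t u _ [-> ->].
Qed.

Lemma mwf_ctx_scoped Γ i A :
  mwf_ctx Γ -> lookup Γ i = Some A -> below i (mvars_ty A).
Proof. by move=> /(mcatt_scoped.1); apply. Qed.

Lemma mwf_ty_scoped Γ A : mwf_ty Γ A -> below (size Γ) (mvars_ty A).
Proof. exact: mcatt_scoped.2.1. Qed.

Lemma mhas_ty_scoped Γ t A : mhas_ty Γ t A -> below (size Γ) (mvars_tm t).
Proof. exact: mcatt_scoped.2.2.1. Qed.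

Lemma mhas_sub_scoped Δ γ Γ : mhas_sub Δ γ Γ -> mclosed_sub (size Δ) γ.
Proof. by case/mcatt_scoped.2.2.2.1. Qed.

Lemma mhas_sub_size Δ γ Γ : mhas_sub Δ γ Γ -> size γ = size Γ.
Proof. by case/mcatt_scoped.2.2.2.1. Qed.

Lemma meq_sub_size Δ γ δ Γ :
  meq_sub Δ γ δ Γ -> size γ = size Γ /\ size δ = size Γ.
Proof. exact: mcatt_scoped.2.2.2.2.2.2. Qed.

Lemma des_ty_scoped Θ A :
  wf_ty Θ A -> below (size (des_ctx Θ)) (mvars_ty (des_ty A)).
Proof. by move=> /wf_ty_scoped; rewrite mvars_des.1 size_des_ctx. Qed.

Lemma mcatt_presup_ctx :
  (forall Γ, mwf_ctx Γ -> True) /\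
  (forall Γ A, mwf_ty Γ A -> mwf_ctx Γ) /\
  (forall Γ t A, mhas_ty Γ t A -> mwf_ctx Γ) /\
  (forall Δ γ Γ, mhas_sub Δ γ Γ -> mwf_ctx Δ /\ mwf_ctx Γ) /\
  (forall Γ A B, meq_ty Γ A B -> True) /\
  (forall Γ t u A, meq_tm Γ t u A -> True) /\
  (forall Δ γ δ Γ, meq_sub Δ γ δ Γ -> True).
Proof.
apply: mcatt_mut => //=.
- by move=> Δ Θ A γ _ _ [].
- by move=> Δ Θ A γ _ _ [].
- by move=> *; split=> //; exact: mwf_nil.
- by move=> Δ γ Γ A t _ [? ?] *; split=> //; exact: mwf_ext.
Qed.

Lemma mwf_ty_ctx Γ A : mwf_ty Γ A -> mwf_ctx Γ.
Proof. exact: mcatt_presup_ctx.2.1. Qed.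

Lemma mhas_sub_ctx Δ γ Γ : mhas_sub Δ γ Γ -> mwf_ctx Δ.
Proof. by case/mcatt_presup_ctx.2.2.2.1. Qed.

Lemma mcatt_weaken :
  (forall Γ, mwf_ctx Γ -> True) /\
  (forall Γ A, mwf_ty Γ A -> forall B, mwf_ctx (B :: Γ) -> mwf_ty (B :: Γ) A) /\
  (forall Γ t A, mhas_ty Γ t A ->
     forall B, mwf_ctx (B :: Γ) -> mhas_ty (B :: Γ) t A) /\
  (forall Δ γ Γ, mhas_sub Δ γ Γ ->
     forall B, mwf_ctx (B :: Δ) -> mhas_sub (B :: Δ) γ Γ) /\
  (forall Γ A A', meq_ty Γ A A' ->
     forall B, mwf_ctx (B :: Γ) -> meq_ty (B :: Γ) A A') /\
  (forall Γ t u A, meq_tm Γ t u A ->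
     forall B, mwf_ctx (B :: Γ) -> meq_tm (B :: Γ) t u A) /\
  (forall Δ γ δ Γ, meq_sub Δ γ δ Γ ->
     forall B, mwf_ctx (B :: Δ) -> meq_sub (B :: Δ) γ δ Γ).
Proof.
apply: mcatt_mut => //.
- by move=> *; exact: mwf_unit.
- by move=> *; apply: mwf_hom; auto.
- move=> Γ i A _ _ lk B wB; apply: mty_var => //.
  by rewrite lookup_cons_lt // (lookup_lt lk).
- by move=> *; exact: mty_tt.
- by move=> Δ Θ A γ oA _ IH B wB; apply: mty_op => //; exact: IH.
- by move=> Δ Θ A γ oA _ IH B wB; apply: mty_coh => //; exact: IH.
- by move=> *; apply: mty_conv; eauto.
- by move=> *; exact: msub_nil.
- by move=> *; apply: msub_ext; auto.
- by move=> *; apply: meq_ty_refl; auto.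
- by move=> *; apply: meq_ty_sym; auto.
- by move=> *; apply: meq_ty_trans; eauto.
- by move=> *; apply: meq_hom; auto.
- by move=> *; apply: meq_tm_refl; auto.
- by move=> *; apply: meq_tm_sym; auto.
- by move=> *; apply: meq_tm_trans; eauto.
- by move=> *; apply: meq_tm_conv; eauto.
- by move=> *; apply: meq_eta; auto.
- by move=> *; apply: meq_op; auto.
- by move=> *; apply: meq_coh; auto.
- by move=> *; exact: meq_nil.
- by move=> *; apply: meq_ext; auto.
Qed.

Lemma mwf_ty_weaken Γ A B : mwf_ctx (B :: Γ) -> mwf_ty Γ A -> mwf_ty (B :: Γ) A.
Proof. by move=> w h; exact: (mcatt_weaken.2.1 _ _ h). Qed.

Lemma mhas_sub_weaken Δ γ Γ B :
  mwf_ctx (B :: Δ) -> mhas_sub Δ γ Γ -> mhas_sub (B :: Δ) γ Γ.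
Proof. by move=> w h; exact: (mcatt_weaken.2.2.2.1 _ _ _ h). Qed.

Lemma mwf_ext_ty Γ A : mwf_ty Γ A -> mwf_ctx (A :: Γ).
Proof. by move=> w; apply: mwf_ext => //; exact: mwf_ty_ctx w. Qed.

Lemma mhas_sub_lookup Δ γ Γ i A :
  mhas_sub Δ γ Γ -> lookup Γ i = Some A ->
  mhas_ty Δ (msub_tm γ (mvar i)) (msub_ty γ A).
Proof.
elim=> // {}Δ {}γ {}Γ B t hγ IH wB ht lk.
have /= sz := mhas_sub_size hγ.
have := mwf_ctx_scoped (mwf_ext_ty wB) lk.
have := lookup_lt lk; rewrite /= ltnS => le /(below_le le); rewrite -sz => cA.
rewrite msub_ty_cons //.
by move: lk => /=; rewrite sz; case: eqP => [_ [<-] //| _ /IH].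
Qed.

Lemma meq_sub_lookup Δ γ δ Γ i A :
  meq_sub Δ γ δ Γ -> lookup Γ i = Some A ->
  meq_tm Δ (msub_tm γ (mvar i)) (msub_tm δ (mvar i)) (msub_ty γ A).
Proof.
elim=> // {}Δ {}γ {}δ {}Γ B t u e IH wB ht lk.
have /= [sz sz'] := meq_sub_size e.
have := mwf_ctx_scoped (mwf_ext_ty wB) lk.
have := lookup_lt lk; rewrite /= ltnS => le /(below_le le); rewrite -sz => cA.
rewrite msub_ty_cons //.
by move: lk => /=; rewrite sz sz'; case: eqP => [_ [<-] //| _ /IH].
Qed.

Lemma mcatt_subst :
  (forall Γ, mwf_ctx Γ -> True) /\
  (forall Γ A, mwf_ty Γ A ->
     forall Δ γ, mhas_sub Δ γ Γ -> mwf_ty Δ (msub_ty γ A)) /\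
  (forall Γ t A, mhas_ty Γ t A ->
     forall Δ γ, mhas_sub Δ γ Γ -> mhas_ty Δ (msub_tm γ t) (msub_ty γ A)) /\
  (forall Γ θ Θ, mhas_sub Γ θ Θ ->
     forall Δ γ, mhas_sub Δ γ Γ -> mhas_sub Δ (msub_comp θ γ) Θ) /\
  (forall Γ A B, meq_ty Γ A B ->
     forall Δ γ, mhas_sub Δ γ Γ -> meq_ty Δ (msub_ty γ A) (msub_ty γ B)) /\
  (forall Γ t u A, meq_tm Γ t u A ->
     forall Δ γ, mhas_sub Δ γ Γ ->
       meq_tm Δ (msub_tm γ t) (msub_tm γ u) (msub_ty γ A)) /\
  (forall Γ θ θ' Θ, meq_sub Γ θ θ' Θ ->
     forall Δ γ, mhas_sub Δ γ Γ ->
       meq_sub Δ (msub_comp θ γ) (msub_comp θ' γ) Θ).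
Proof.
apply: mcatt_mut => //.
- by move=> Γ _ _ Δ γ /mhas_sub_ctx w; exact: mwf_unit.
- by move=> *; apply: mwf_hom; auto.
- by move=> Γ i A _ _ lk Δ γ hγ; exact: mhas_sub_lookup lk.
- by move=> Γ _ _ Δ γ /mhas_sub_ctx w; exact: mty_tt.
- move=> Γ Θ A θ oA hθ IH Δ γ hγ.
  rewrite (msub_sub _ _).1; last first.
    by rewrite (mhas_sub_size hθ); apply: des_ty_scoped (op_ty_wf oA).
  by apply: mty_op => //; exact: IH.
- move=> Γ Θ A θ oA hθ IH Δ γ hγ.
  rewrite (msub_sub _ _).1; last first.
    by rewrite (mhas_sub_size hθ); apply: des_ty_scoped (coh_ty_wf oA).
  by apply: mty_coh => //; exact: IH.
- by move=> *; apply: mty_conv; eauto.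
- by move=> Γ _ _ Δ γ /mhas_sub_ctx w; exact: msub_nil.
- move=> Γ θ Θ A t hθ IH wA _ _ IHt Δ γ hγ; apply: msub_ext => //.
    exact: IH.
  rewrite -(msub_sub _ _).1; first exact: IHt.
  by rewrite (mhas_sub_size hθ); exact: mwf_ty_scoped wA.
- by move=> *; apply: meq_ty_refl; auto.
- by move=> *; apply: meq_ty_sym; auto.
- by move=> *; apply: meq_ty_trans; eauto.
- by move=> *; apply: meq_hom; auto.
- by move=> *; apply: meq_tm_refl; auto.
- by move=> *; apply: meq_tm_sym; auto.
- by move=> *; apply: meq_tm_trans; eauto.
- by move=> *; apply: meq_tm_conv; eauto.
- by move=> *; apply: meq_eta; auto.
- move=> Γ Θ A θ θ' oA e IH Δ γ hγ.
  rewrite (msub_sub _ _).1; last first.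
    by rewrite (meq_sub_size e).1; apply: des_ty_scoped (op_ty_wf oA).
  by apply: meq_op => //; exact: IH.
- move=> Γ Θ A θ θ' oA e IH Δ γ hγ.
  rewrite (msub_sub _ _).1; last first.
    by rewrite (meq_sub_size e).1; apply: des_ty_scoped (coh_ty_wf oA).
  by apply: meq_coh => //; exact: IH.
- by move=> Γ _ _ Δ γ /mhas_sub_ctx w; exact: meq_nil.
- move=> Γ θ θ' Θ A t u e IH wA _ _ IHt Δ γ hγ; apply: meq_ext => //.
    exact: IH.
  rewrite -(msub_sub _ _).1; first exact: IHt.
  by rewrite (meq_sub_size e).1; exact: mwf_ty_scoped wA.
Qed.

Lemma mwf_ty_sub Γ A Δ γ :
  mhas_sub Δ γ Γ -> mwf_ty Γ A -> mwf_ty Δ (msub_ty γ A).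
Proof. by move=> h w; exact: (mcatt_subst.2.1 _ _ w). Qed.

Lemma mhas_ty_sub Γ t A Δ γ :
  mhas_sub Δ γ Γ -> mhas_ty Γ t A -> mhas_ty Δ (msub_tm γ t) (msub_ty γ A).
Proof. by move=> h w; exact: (mcatt_subst.2.2.1 _ _ _ w). Qed.

Lemma mhas_sub_comp Γ θ Θ Δ γ :
  mhas_sub Γ θ Θ -> mhas_sub Δ γ Γ -> mhas_sub Δ (msub_comp θ γ) Θ.
Proof. by move=> w h; exact: (mcatt_subst.2.2.2.1 _ _ _ w). Qed.

Lemma meq_ty_sub Γ A B Δ γ :
  mhas_sub Δ γ Γ -> meq_ty Γ A B -> meq_ty Δ (msub_ty γ A) (msub_ty γ B).
Proof. by move=> h w; exact: (mcatt_subst.2.2.2.2.1 _ _ _ w). Qed.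

Lemma meq_tm_sub Γ t u A Δ γ : mhas_sub Δ γ Γ -> meq_tm Γ t u A ->
  meq_tm Δ (msub_tm γ t) (msub_tm γ u) (msub_ty γ A).
Proof. by move=> h w; exact: (mcatt_subst.2.2.2.2.2.1 _ _ _ _ w). Qed.

Lemma meq_sub_comp_l Γ θ θ' Θ Δ γ : mhas_sub Δ γ Γ -> meq_sub Γ θ θ' Θ ->
  meq_sub Δ (msub_comp θ γ) (msub_comp θ' γ) Θ.
Proof. by move=> h w; exact: (mcatt_subst.2.2.2.2.2.2 _ _ _ _ w). Qed.

Lemma mcatt_functional :
  (forall Γ, mwf_ctx Γ -> True) /\
  (forall Γ A, mwf_ty Γ A ->
     forall Δ γ δ, mhas_sub Δ γ Γ -> meq_sub Δ γ δ Γ ->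
       meq_ty Δ (msub_ty γ A) (msub_ty δ A)) /\
  (forall Γ t A, mhas_ty Γ t A ->
     forall Δ γ δ, mhas_sub Δ γ Γ -> meq_sub Δ γ δ Γ ->
       meq_tm Δ (msub_tm γ t) (msub_tm δ t) (msub_ty γ A)) /\
  (forall Γ θ Θ, mhas_sub Γ θ Θ ->
     forall Δ γ δ, mhas_sub Δ γ Γ -> meq_sub Δ γ δ Γ ->
       meq_sub Δ (msub_comp θ γ) (msub_comp θ δ) Θ) /\
  (forall Γ A B, meq_ty Γ A B -> True) /\
  (forall Γ t u A, meq_tm Γ t u A -> True) /\
  (forall Γ θ θ' Θ, meq_sub Γ θ θ' Θ -> True).
Proof.
apply: mcatt_mut => //.
- move=> Γ _ _ Δ γ δ /mhas_sub_ctx w _.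
  by apply: meq_ty_refl; exact: mwf_unit.
- by move=> *; apply: meq_hom; auto.
- by move=> Γ i A _ _ lk Δ γ δ _ e; exact: meq_sub_lookup lk.
- move=> Γ _ _ Δ γ δ /mhas_sub_ctx w _.
  by apply: meq_tm_refl; exact: mty_tt.
- move=> Γ Θ A θ oA hθ IH Δ γ δ hγ e.
  rewrite (msub_sub _ _).1; last first.
    by rewrite (mhas_sub_size hθ); apply: des_ty_scoped (op_ty_wf oA).
  by apply: meq_op => //; exact: IH.
- move=> Γ Θ A θ oA hθ IH Δ γ δ hγ e.
  rewrite (msub_sub _ _).1; last first.
    by rewrite (mhas_sub_size hθ); apply: des_ty_scoped (coh_ty_wf oA).
  by apply: meq_coh => //; exact: IH.
- move=> Γ t A B _ IH eAB _ Δ γ δ hγ e.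
  by apply: meq_tm_conv (IH _ _ _ hγ e) _; exact: meq_ty_sub eAB.
- by move=> Γ _ _ Δ γ δ /mhas_sub_ctx w _; exact: meq_nil.
- move=> Γ θ Θ A t hθ IH wA _ _ IHt Δ γ δ hγ e; apply: meq_ext => //.
    exact: IH.
  rewrite -(msub_sub _ _).1; first exact: IHt.
  by rewrite (mhas_sub_size hθ); exact: mwf_ty_scoped wA.
Qed.

Lemma mwf_ty_functional Γ A Δ γ δ : mwf_ty Γ A ->
  mhas_sub Δ γ Γ -> meq_sub Δ γ δ Γ -> meq_ty Δ (msub_ty γ A) (msub_ty δ A).
Proof. by move=> w; exact: (mcatt_functional.2.1 _ _ w). Qed.

Lemma mhas_ty_functional Γ t A Δ γ δ : mhas_ty Γ t A ->
  mhas_sub Δ γ Γ -> meq_sub Δ γ δ Γ ->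
  meq_tm Δ (msub_tm γ t) (msub_tm δ t) (msub_ty γ A).
Proof. by move=> w; exact: (mcatt_functional.2.2.1 _ _ _ w). Qed.

Lemma meq_sub_comp_r Γ θ Θ Δ γ δ : mhas_sub Γ θ Θ ->
  mhas_sub Δ γ Γ -> meq_sub Δ γ δ Γ ->
  meq_sub Δ (msub_comp θ γ) (msub_comp θ δ) Θ.
Proof. by move=> w; exact: (mcatt_functional.2.2.2.1 _ _ _ w). Qed.

Lemma mcatt_presup :
  (forall Γ, mwf_ctx Γ -> True) /\
  (forall Γ A, mwf_ty Γ A -> True) /\
  (forall Γ t A, mhas_ty Γ t A -> True) /\
  (forall Δ γ Γ, mhas_sub Δ γ Γ -> True) /\
  (forall Γ A B, meq_ty Γ A B -> mwf_ty Γ A /\ mwf_ty Γ B) /\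
  (forall Γ t u A, meq_tm Γ t u A -> mhas_ty Γ t A /\ mhas_ty Γ u A) /\
  (forall Δ γ δ Γ, meq_sub Δ γ δ Γ -> mhas_sub Δ γ Γ /\ mhas_sub Δ δ Γ).
Proof.
apply: mcatt_mut => //.
- by move=> Γ A B _ [].
- by move=> Γ A B C _ [? _] _ [].
- move=> Γ A B t t' u u' e [? ?] _ [? ?] _ [? ?].
  by split; apply: mwf_hom => //; apply: mty_conv e.
- by move=> Γ t u A _ [].
- by move=> Γ t u v A _ [? _] _ [].
- by move=> Γ t u A B _ [? ?] e _; split; apply: mty_conv e.
- move=> Γ t h _; split=> //; apply: mty_tt.
  exact: mcatt_presup_ctx.2.2.1 h.
- move=> Δ Θ A γ δ oA e [hγ hδ]; split; first exact: mty_op.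
  apply: mty_conv; first exact: mty_op hδ.
  apply: meq_ty_sym; apply: mwf_ty_functional hγ e.
  by apply: des_wf_ty; exact: op_ty_wf.
- move=> Δ Θ A γ δ oA e [hγ hδ]; split; first exact: mty_coh.
  apply: mty_conv; first exact: mty_coh hδ.
  apply: meq_ty_sym; apply: mwf_ty_functional hγ e.
  by apply: des_wf_ty; exact: coh_ty_wf.
- by move=> *; split; exact: msub_nil.
- move=> Δ γ δ Γ A t u e [hγ hδ] wA _ _ [ht hu].
  split; apply: msub_ext => //.
  by apply: mty_conv hu _; exact: mwf_ty_functional hγ e.
Qed.

Lemma meq_sub_refl Δ γ Γ : mhas_sub Δ γ Γ -> meq_sub Δ γ γ Γ.
Proof.
elim=> *; first exact: meq_nil.
by apply: meq_ext => //; exact: meq_tm_refl.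
Qed.

Lemma meq_sub_sym Δ γ δ Γ : meq_sub Δ γ δ Γ -> meq_sub Δ δ γ Γ.
Proof.
elim=> [|{}Δ {}γ {}δ {}Γ A t u e IH wA etu]; first by move=> *; exact: meq_nil.
apply: meq_ext => //; apply: meq_tm_conv; first exact: meq_tm_sym etu.
by apply: (mwf_ty_functional wA _ e); case/mcatt_presup.2.2.2.2.2.2: e.
Qed.

Lemma meq_sub_cons_inv Δ γ δ A Γ : meq_sub Δ γ δ (A :: Γ) ->
  exists t γ' u δ', [/\ γ = t :: γ', δ = u :: δ', meq_sub Δ γ' δ' Γ
    & meq_tm Δ t u (msub_ty γ' A)].
Proof. by move=> h; inversion_clear h; do 4 eexists; split. Qed.

Lemma meq_sub_nil_inv Δ γ δ : meq_sub Δ γ δ [::] -> γ = [::] /\ δ = [::].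
Proof. by move=> h; inversion_clear h. Qed.

Lemma meq_sub_trans Δ γ δ θ Γ :
  meq_sub Δ γ δ Γ -> meq_sub Δ δ θ Γ -> meq_sub Δ γ θ Γ.
Proof.
move=> e; elim: e θ => [{}Δ w|{}Δ {}γ {}δ {}Γ A t u e IH wA etu] θ.
  by move=> /meq_sub_nil_inv [_ ->]; exact: meq_nil.
move=> /meq_sub_cons_inv [_ [_ [v [θ' [[<- <-] -> e' euv]]]]].
apply: meq_ext => //; first exact: IH.
apply: meq_tm_trans etu _; apply: meq_tm_conv euv _.
apply: meq_ty_sym; apply: (mwf_ty_functional wA _ e).
by case/mcatt_presup.2.2.2.2.2.2: e.
Qed.

Lemma meq_sub_comp Γ θ θ' Θ Δ γ δ :
  mhas_sub Δ γ Γ -> mhas_sub Γ θ' Θ ->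
  meq_sub Γ θ θ' Θ -> meq_sub Δ γ δ Γ ->
  meq_sub Δ (msub_comp θ γ) (msub_comp θ' δ) Θ.
Proof.
move=> hγ hθ' e e'; apply: (@meq_sub_trans _ _ (msub_comp θ' γ)).
  exact: meq_sub_comp_l e.
exact: meq_sub_comp_r e'.
Qed.

Lemma mhas_sub_id Γ : mwf_ctx Γ -> mhas_sub Γ (mid_sub (size Γ)) Γ.
Proof.
elim: Γ => [|A Γ IH] w; first exact: msub_nil.
inversion_clear w as [|? ? wΓ wA].
have w' : mwf_ctx (A :: Γ) by exact: mwf_ext.
apply: msub_ext => //; first by apply: mhas_sub_weaken => //; exact: IH.
by rewrite (msub_id _).1; apply: mty_var => //=; rewrite eqxx.
Qed.

Lemma mhas_sub_proj Γ A :
  mwf_ty Γ A -> mhas_sub (A :: Γ) (mid_sub (size Γ)) Γ.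
Proof.
move=> wA; apply: mhas_sub_weaken (mhas_sub_id (mwf_ty_ctx wA)).
exact: mwf_ext_ty.
Qed.

Lemma mhas_sub_compA Γ θ Θ Δ γ Ξ δ :
  mhas_sub Γ θ Θ -> mhas_sub Δ γ Γ -> mhas_sub Ξ δ Δ ->
  msub_comp (msub_comp θ γ) δ = msub_comp θ (msub_comp γ δ).
Proof.
move=> hθ hγ hδ; apply: msub_comp_assoc.
by rewrite (mhas_sub_size hγ); exact: mhas_sub_scoped hθ.
Qed.

Lemma mhas_sub_idl Δ γ Γ :
  mhas_sub Δ γ Γ -> msub_comp (mid_sub (size Γ)) γ = γ.
Proof. by move=> /mhas_sub_size <-; exact: msub_comp_idl. Qed.

Lemma mhas_sub_cons_inv Δ γ A Γ : mhas_sub Δ γ (A :: Γ) ->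
  exists t γ', [/\ γ = t :: γ', mhas_sub Δ γ' Γ
    & mhas_ty Δ t (msub_ty γ' A)].
Proof. by move=> h; inversion_clear h; do 2 eexists; split. Qed.

Lemma size_sus_ctx Γ : size (sus_ctx Γ) = (count nonunit Γ).+1.
Proof. by elim: Γ => //= A Γ IH; case: nonunit => //=; rewrite IH. Qed.

Lemma size_sus_vars Γ : size (sus_vars Γ) = size Γ.
Proof. by elim: Γ => //= A Γ ->. Qed.

Lemma closed_sus_vars Γ : closed_sub (count nonunit Γ).+1 (sus_vars Γ).
Proof.
elim: Γ => //= A Γ IH; case: nonunit => //=.
rewrite /below /= ltnSn /=.
by apply: sub_all IH => t; apply: below_le; rewrite add1n.
Qed.

Lemma nonunit_des A : nonunit (des_ty A) = if A is star then false else true.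
Proof. by case: A. Qed.

Lemma lookup_rcons0 (T : Type) (s : seq T) a : lookup (rcons s a) 0 = Some a.
Proof. by elim: s => //= b s ->; rewrite size_rcons. Qed.

Lemma lookup_sus_ctx0 Γ : lookup (sus_ctx Γ) 0 = Some star.
Proof. by elim: Γ => //= A Γ IH; case: nonunit => //=; rewrite size_sus_ctx. Qed.

Lemma size_sus_entries (Γ : mctx) s :
  size s = size Γ -> size (sus_entries Γ s) = (count nonunit Γ).+1.
Proof.
by move=> sz; rewrite size_rcons size_mask ?size_map // count_map; congr _.+1.
Qed.

Lemma sus_entries_map Γ f s : f (var 0) = var 0 ->
  sus_entries Γ (map f s) = map f (sus_entries Γ s).
Proof. by move=> f0; rewrite /sus_entries map_rcons f0 map_mask. Qed.

Lemma sus_entries_cons A Γ t s :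
  sus_entries (A :: Γ) (t :: s) =
  if nonunit A then t :: sus_entries Γ s else sus_entries Γ s.
Proof. by rewrite /sus_entries /=; case: nonunit. Qed.

Lemma sub_tm_sus_entries0 Γ s : sub_tm (sus_entries Γ s) (var 0) = var 0.
Proof. by rewrite /sub_tm lookup_rcons0. Qed.

Fixpoint units_collapse (Γ : mctx) (s : sub) : Prop :=
  match Γ, s with
  | [::], [::] => True
  | A :: Γ', t :: s' => (~~ nonunit A -> t = var 0) /\ units_collapse Γ' s'
  | _, _ => False
  end.

Lemma units_collapse_size Γ s : units_collapse Γ s -> size s = size Γ.
Proof. by elim: Γ s => [|A Γ IH] [|t s] //= [_ /IH ->]. Qed.

Lemma sub_comp_sus_vars Γ s :
  units_collapse Γ s -> sub_comp (sus_vars Γ) (sus_entries Γ s) = s.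
Proof.
elim: Γ s => [|A Γ IH] [|t s] //= [u ok].
have sz := size_sus_entries (units_collapse_size ok).
move: u; rewrite sus_entries_cons; case: nonunit => /= u.
  rewrite sz eqxx /=; congr (_ :: _); rewrite -[RHS](IH _ ok).
  by apply: sub_comp_cons; rewrite sz; exact: closed_sus_vars.
by rewrite u // [lookup _ _]lookup_rcons0 /=; congr (_ :: _); exact: IH.
Qed.

Lemma sus_agree (ρ σ : sub) :
  (forall A, {in mvars_ty A, forall i, lookup ρ i = lookup σ i} ->
     sus_ty ρ A = sus_ty σ A) /\
  (forall t, {in mvars_tm t, forall i, lookup ρ i = lookup σ i} ->
     sus_tm ρ t = sus_tm σ t).
Proof.
have aux : forall s,
    List.Forall (fun t =>
      {in mvars_tm t, forall i, lookup ρ i = lookup σ i} ->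
      sus_tm ρ t = sus_tm σ t) s ->
    {in flatten (map mvars_tm s), forall i, lookup ρ i = lookup σ i} ->
    map (sus_tm ρ) s = map (sus_tm σ) s.
  move=> s; elim=> //= t s' IHt _ IHs H.
  rewrite IHt => [|i i_t]; last by apply: H; rewrite mem_cat i_t.
  by rewrite IHs // => i i_s; apply: H; rewrite mem_cat i_s orbT.
apply: mty_tm_ind => //=.
- move=> A t u IHA IHt IHu H.
  rewrite IHA ?IHt ?IHu // => i i_in; apply: H;
    by rewrite !mem_cat i_in ?orbT.
- by move=> i ->; rewrite ?inE.
- by move=> Θ A s IH H; rewrite (aux _ IH H).
- by move=> Θ A s IH H; rewrite (aux _ IH H).
Qed.

Lemma sus_ty_cons a (ρ : sub) A :
  below (size ρ) (mvars_ty A) -> sus_ty (a :: ρ) A = sus_ty ρ A.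
Proof.
by move=> /allP cl; apply: (sus_agree _ _).1 => i /cl lt; exact: lookup_cons_lt.
Qed.

Lemma meq_ty_unit Γ A B : meq_ty Γ A B -> A = munit <-> B = munit.
Proof.
elim=> //.
- by move=> ? ? ? _ [? ?]; split.
- by move=> ? ? ? ? _ [? ?] _ [? ?]; split; auto.
Qed.

Lemma sus_tm_unit Γ t A :
  mhas_ty Γ t A -> A = munit -> sus_tm (sus_vars Γ) t = var 0.
Proof.
elim=> //=.
- move=> {}Γ i {}A _ lk A1; move: lk; rewrite {}A1.
  elim: Γ => //= B Γ IH; rewrite size_sus_vars.
  by case: eqP => [_ [->] | _ /IH].
- by move=> Δ Θ {}A γ oA _; case: A oA => // /op_ty_neq_star.
- by move=> Δ Θ {}A γ oA _; case: A oA => // /coh_ty_neq_star.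
- by move=> {}Γ {}t {}A B _ IH /meq_ty_unit e /e.
Qed.

Lemma sus_units_collapse Δ γ Γ : mhas_sub Δ γ Γ ->
  units_collapse Γ (map (sus_tm (sus_vars Δ)) γ).
Proof.
elim=> //= {}Δ {}γ {}Γ A t _ ok _ ht; split=> //.
by case: A ht => //= ht _; apply: sus_tm_unit ht _.
Qed.

Lemma sus_sub_vars Δ γ Γ : mhas_sub Δ γ Γ ->
  sub_comp (sus_vars Γ) (sus_sub Δ Γ γ) = map (sus_tm (sus_vars Δ)) γ.
Proof. by move=> /sus_units_collapse; exact: sub_comp_sus_vars. Qed.

Lemma sus_subst :
  (forall Γ, mwf_ctx Γ -> True) /\
  (forall Γ A, mwf_ty Γ A -> forall Δ γ, mhas_sub Δ γ Γ ->
     sus_ty (sus_vars Δ) (msub_ty γ A) =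
     sub_ty (sus_sub Δ Γ γ) (sus_ty (sus_vars Γ) A)) /\
  (forall Γ t A, mhas_ty Γ t A -> forall Δ γ, mhas_sub Δ γ Γ ->
     sus_tm (sus_vars Δ) (msub_tm γ t) =
     sub_tm (sus_sub Δ Γ γ) (sus_tm (sus_vars Γ) t)) /\
  (forall Γ θ Θ, mhas_sub Γ θ Θ -> forall Δ γ, mhas_sub Δ γ Γ ->
     map (sus_tm (sus_vars Δ)) (msub_comp θ γ) =
     sub_comp (map (sus_tm (sus_vars Γ)) θ) (sus_sub Δ Γ γ)) /\
  (forall Γ A B, meq_ty Γ A B -> True) /\
  (forall Γ t u A, meq_tm Γ t u A -> True) /\
  (forall Γ θ θ' Θ, meq_sub Γ θ θ' Θ -> True).
Proof.
apply: mcatt_mut => //.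
- by move=> Γ A t u _ IHA _ IHt _ IHu Δ γ hγ /=; rewrite IHA // IHt // IHu.
- move=> Γ i A _ _ lk Δ γ hγ /=.
  have := congr1 (fun s => lookup s i) (sus_sub_vars hγ).
  have lt := lookup_lt lk.
  rewrite !lookup_map; case: (@lookup_some _ (sus_vars Γ) i) => [|v ->] /=.
    by rewrite size_sus_vars.
  case: (@lookup_some _ γ i) => [|t ->] /=; first by rewrite (mhas_sub_size hγ).
  by case.
- by move=> Γ _ _ Δ γ hγ /=; rewrite lookup_rcons0.
- move=> Γ Θ A θ oA hθ IH Δ γ hγ /=; congr op.
  rewrite [map _ (map _ _)](IH _ _ hγ) sus_entries_map ?sub_tm_sus_entries0 //.
  rewrite -[RHS]/(sub_comp _ _) sub_comp_assoc //.
  rewrite size_sus_entries ?size_map ?(mhas_sub_size hθ) ?size_des_ctx //.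
  exact: closed_sus_vars.
- move=> Γ Θ A θ oA hθ IH Δ γ hγ /=; congr coh.
  rewrite [map _ (map _ _)](IH _ _ hγ) sus_entries_map ?sub_tm_sus_entries0 //.
  rewrite -[RHS]/(sub_comp _ _) sub_comp_assoc //.
  rewrite size_sus_entries ?size_map ?(mhas_sub_size hθ) ?size_des_ctx //.
  exact: closed_sus_vars.
- by move=> Γ θ Θ A t _ IH _ _ _ IHt Δ γ hγ /=; rewrite IHt // IH.
Qed.

(** Suspending a desuspended expression of [Γ] amounts to applying [•_Γ]. *)
Lemma sus_des :
  (forall Γ, wf_ctx Γ -> True) /\
  (forall Γ A, wf_ty Γ A ->
     sus_ty (bullet Γ) (des_ty A) = sub_ty (bullet Γ) A) /\
  (forall Γ t A, has_ty Γ t A ->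
     sus_tm (bullet Γ) (des_tm t) = sub_tm (bullet Γ) t) /\
  (forall Γ θ Θ, has_sub Γ θ Θ ->
     map (sus_tm (bullet Γ)) (des_sub θ) = sub_comp θ (bullet Γ)) /\
  (forall Θ A, op_ty Θ A -> True) /\
  (forall Θ A, coh_ty Θ A -> True).
Proof.
apply: catt_mut => //=.
- by move=> Γ A t u _ -> _ -> _ ->.
- move=> Γ i A _ _ lk.
  case: (@lookup_some _ (bullet Γ) i) => [|v -> //].
  by rewrite size_sus_vars size_des_ctx; exact: lookup_lt lk.
- move=> Γ Θ A θ oA _ hθ IH; congr op; rewrite -[RHS]IH.
  exact/sub_comp_sus_vars/sus_units_collapse/des_has_sub.
- move=> Γ Θ A θ oA _ hθ IH; congr coh; rewrite -[RHS]IH.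
  exact/sub_comp_sus_vars/sus_units_collapse/des_has_sub.
- by move=> Γ θ Θ A t _ IH _ _ _ IHt; rewrite IHt IH.
Qed.

Lemma bullet_typed Θ : wf_ctx Θ ->
  has_sub (sus_ctx (des_ctx Θ)) (bullet Θ) Θ.
Proof.
elim: Θ => [|A Θ IH] w.
  by apply: sub_nil; apply: wf_ext; [exact: wf_nil | apply: wf_star; exact: wf_nil].
inversion_clear w as [|? ? wΘ wA]; have h := IH wΘ.
have [wS _] := catt_presup.2.2.2.1 _ _ _ h.
rewrite /bullet /= nonunit_des.
case: A wA => [|A t u] wA.
  by apply: sub_ext => //; apply: ty_var => //; exact: lookup_sus_ctx0.
have e := sus_des.2.1 _ _ wA; rewrite -/(bullet Θ) e.
have wB := wf_ty_sub h wA.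
have w' : wf_ctx (sub_ty (bullet Θ) (hom A t u) :: sus_ctx (des_ctx Θ)).
  exact: wf_ext.
apply: sub_ext => //; first exact: has_sub_weaken.
by apply: ty_var => //=; rewrite size_sus_ctx eqxx.
Qed.

Lemma sus_var_typed Γ i A : mwf_ctx Γ -> wf_ctx (sus_ctx Γ) ->
  lookup Γ i = Some A ->
  has_ty (sus_ctx Γ) (sus_tm (sus_vars Γ) (mvar i)) (sus_ty (sus_vars Γ) A).
Proof.
elim: Γ => // B Γ IH w wS lk.
inversion_clear w as [|? ? wΓ wB].
have := mwf_ctx_scoped (mwf_ext_ty wB) lk.
have := lookup_lt lk; rewrite /= ltnS => le /(below_le le).
rewrite -size_sus_vars => cA; rewrite sus_ty_cons // size_sus_vars.
move: lk wS => /=; case: eqP => [_ [<-]|_ lk].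
  case: B {wB} => [|B t u] /= wS.
    by apply: ty_var => //; exact: lookup_sus_ctx0.
  by apply: ty_var => //=; rewrite size_sus_ctx eqxx.
case: nonunit => wS; last exact: IH.
apply: has_ty_weaken => //; apply: IH => //.
by inversion_clear wS.
Qed.

Lemma sus_typed :
  (forall Γ, mwf_ctx Γ -> wf_ctx (sus_ctx Γ)) /\
  (forall Γ A, mwf_ty Γ A -> wf_ty (sus_ctx Γ) (sus_ty (sus_vars Γ) A)) /\
  (forall Γ t A, mhas_ty Γ t A ->
     has_ty (sus_ctx Γ) (sus_tm (sus_vars Γ) t) (sus_ty (sus_vars Γ) A)) /\
  (forall Δ γ Γ, mhas_sub Δ γ Γ ->
     has_sub (sus_ctx Δ) (sus_sub Δ Γ γ) (sus_ctx Γ)) /\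
  (forall Γ A B, meq_ty Γ A B ->
     sus_ty (sus_vars Γ) A = sus_ty (sus_vars Γ) B) /\
  (forall Γ t u A, meq_tm Γ t u A ->
     sus_tm (sus_vars Γ) t = sus_tm (sus_vars Γ) u) /\
  (forall Δ γ δ Γ, meq_sub Δ γ δ Γ ->
     map (sus_tm (sus_vars Δ)) γ = map (sus_tm (sus_vars Δ)) δ).
Proof.
apply: mcatt_mut => //=.
- by apply: wf_ext; [exact: wf_nil | apply: wf_star; exact: wf_nil].
- by move=> Γ A _ wS _ wA; case: nonunit => //; exact: wf_ext.
- by move=> Γ _ wS; exact: wf_star.
- by move=> Γ A t u _ ? _ ? _ ?; exact: wf_hom.
- by move=> Γ i A w wS lk; exact: sus_var_typed lk.
- by move=> Γ _ wS; apply: ty_var => //; exact: lookup_sus_ctx0.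
- move=> Δ Θ A γ oA hγ IH; have wA := op_ty_wf oA.
  have hb := bullet_typed (wf_ty_ctx wA).
  rewrite (sus_subst.2.1 _ _ (des_wf_ty wA)) // (sus_des.2.1 _ _ wA).
  rewrite (sub_sub _ _).1; last by rewrite (has_sub_size hb) wf_ty_scoped.
  by apply: ty_op => //; exact: has_sub_comp hb IH.
- move=> Δ Θ A γ oA hγ IH; have wA := coh_ty_wf oA.
  have hb := bullet_typed (wf_ty_ctx wA).
  rewrite (sus_subst.2.1 _ _ (des_wf_ty wA)) // (sus_des.2.1 _ _ wA).
  rewrite (sub_sub _ _).1; last by rewrite (has_sub_size hb) wf_ty_scoped.
  by apply: ty_coh => //; exact: has_sub_comp hb IH.
- by move=> Γ t A B _ ht _ <-.
- move=> Δ _ wS; apply: (@sub_ext _ [::]); first exact: sub_nil.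
    by apply: wf_star; exact: wf_nil.
  by apply: ty_var => //; exact: lookup_sus_ctx0.
- move=> Δ γ Γ A t hγ IH wA wA' ht ht'; rewrite /sus_sub /= sus_entries_cons.
  case: ifP => // _; apply: sub_ext => //.
  by rewrite -(sus_subst.2.1 _ _ wA).
- by move=> Γ A B C _ -> _ ->.
- by move=> Γ A B t t' u u' _ -> _ -> _ ->.
- by move=> Γ t u v A _ -> _ ->.
- by move=> Γ t ht _; apply: sus_tm_unit ht _.
- by move=> Δ Θ A γ δ _ _ ->.
- by move=> Δ Θ A γ δ _ _ ->.
- by move=> Δ γ δ Γ A t u _ -> _ _ _ ->.
Qed.

Lemma sus_sub_typed Δ γ Γ : mhas_sub Δ γ Γ ->
  has_sub (sus_ctx Δ) (sus_sub Δ Γ γ) (sus_ctx Γ).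
Proof. exact: sus_typed.2.2.2.1. Qed.

Lemma sus_sub_proper Δ γ δ Γ :
  meq_sub Δ γ δ Γ -> sus_sub Δ Γ γ = sus_sub Δ Γ δ.
Proof. by rewrite /sus_sub => /(sus_typed.2.2.2.2.2.2) ->. Qed.

Lemma sus_sub_comp Ξ δ Δ γ Γ : mhas_sub Δ γ Γ -> mhas_sub Ξ δ Δ ->
  sus_sub Ξ Γ (msub_comp γ δ) = sub_comp (sus_sub Δ Γ γ) (sus_sub Ξ Δ δ).
Proof.
move=> hγ hδ; rewrite {1}/sus_sub (sus_subst.2.2.2.1 _ _ _ hγ _ _ hδ).
by rewrite sus_entries_map // sub_tm_sus_entries0.
Qed.

Lemma sus_vars_mid Γ : map (sus_tm (sus_vars Γ)) (mid_sub (size Γ)) = sus_vars Γ.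
Proof.
elim: Γ => //= A Γ IH; rewrite size_sus_vars eqxx /=; congr (_ :: _).
rewrite -[RHS]IH; have := mclosed_mid_sub (size Γ).
elim: (mid_sub _) => //= t s IHs /andP[/allP ct /IHs ->]; congr (_ :: _).
apply: (sus_agree _ _).2 => i /ct lt.
by rewrite lookup_cons_lt // size_sus_vars.
Qed.

Lemma sus_sub_id Γ : sus_sub Γ Γ (mid_sub (size Γ)) = id_sub (size (sus_ctx Γ)).
Proof.
rewrite /sus_sub sus_vars_mid size_sus_ctx.
by elim: Γ => //= A Γ; rewrite sus_entries_cons; case: nonunit => //= ->.
Qed.

#[local] Obligation Tactic := idtac.

Program Definition SynCaTT_cat : Category :=
  {| obj := {Γ : ctx | wf_ctx Γ};
     mor := fun Δ Γ => {γ : sub | has_sub (sval Δ) γ (sval Γ)};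
     mor_eq := fun Δ Γ γ δ => sval γ = sval δ;
     idc := fun Γ => exist _ (id_sub (size (sval Γ))) (has_sub_id (svalP Γ));
     comp := fun Θ Δ Γ γ δ =>
       exist _ (sub_comp (sval γ) (sval δ))
         (has_sub_comp (svalP γ) (svalP δ)) |}.
Next Obligation.
by move=> Δ Γ; split; [move=> γ | move=> γ δ e | move=> γ δ θ /= ->].
Qed.
Next Obligation. by move=> Θ Δ Γ γ γ' δ δ' /= -> ->. Qed.
Next Obligation. by move=> Δ Γ [γ h] /=; exact: has_sub_idl h. Qed.
Next Obligation. by move=> Δ Γ γ; exact: sub_comp_idr. Qed.
Next Obligation.
by move=> Ξ Θ Δ Γ [γ h] [δ h'] [θ h''] /=; rewrite (has_sub_compA h h' h'').
Qed.

Program Definition SynCaTT : CwF :=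
  {| cwf_cat := SynCaTT_cat;
     empty := exist _ [::] wf_nil;
     Ty := fun Γ => {A : ty | wf_ty (sval Γ) A};
     ty_eq := fun Γ A B => sval A = sval B;
     Tm := fun Γ A => {t : tm | has_ty (sval Γ) t (sval A)};
     tm_eq := fun Γ A B t u => sval A = sval B /\ sval t = sval u;
     ty_sub := fun Γ Δ A γ =>
       exist _ (sub_ty (sval γ) (sval A)) (wf_ty_sub (svalP γ) (svalP A));
     tm_sub := fun Γ Δ A t γ =>
       exist _ (sub_tm (sval γ) (sval t)) (has_ty_sub (svalP γ) (svalP t));
     extend := fun Γ A =>
       exist _ (sval A :: sval Γ) (wf_ext (svalP Γ) (svalP A));
     display := fun Γ A =>
       exist _ (id_sub (size (sval Γ))) (has_sub_proj (svalP A));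
     generic := fun Γ A => exist _ (var (size (sval Γ))) _ |}.
Next Obligation.
case=> Γ wΓ /=; exists (exist (fun γ => has_sub Γ γ [::]) [::] (sub_nil wΓ)) => -[γ h] /=.
by inversion_clear h.
Qed.
Next Obligation.
by move=> Γ; split; [move=> A | move=> A B e | move=> A B C /= ->].
Qed.
Next Obligation. by move=> Γ A B t u []. Qed.
Next Obligation. by []. Qed.
Next Obligation. by move=> Γ A B t u [e e']; split; symmetry. Qed.
Next Obligation.
move=> Γ A B C t u v [e1 e1'] [e2 e2'].
by split; [exact: etrans e1 e2 | exact: etrans e1' e2'].
Qed.
Next Obligation.
by move=> Γ [A wA] [B wB] /= e; case: B / e wB => wB t; exists t; split.
Qed.
Next Obligation. by move=> Γ Δ A B γ δ /= -> ->. Qed.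
Next Obligation. by move=> Γ A; exact: (sub_id _).1. Qed.
Next Obligation.
move=> Γ Δ Θ [A wA] [γ hγ] δ /=; rewrite -(sub_sub _ _).1 //.
by rewrite (has_sub_size hγ); exact: wf_ty_scoped.
Qed.
Next Obligation.
by move=> Γ Δ [A wA] [B wB] [t ht] [u hu] [γ h] [δ h'] /= [-> ->] ->.
Qed.
Next Obligation. by move=> Γ A t /=; rewrite (sub_id _).1 (sub_id _).2. Qed.
Next Obligation.
move=> Γ Δ Θ [A wA] [t ht] [γ hγ] δ /=.
rewrite -(sub_sub _ _).1 -?(sub_sub _ _).2 // (has_sub_size hγ).
  exact: has_ty_scoped ht.
exact: wf_ty_scoped.
Qed.
Next Obligation.
move=> Γ A /=; rewrite (sub_id _).1; apply: ty_var.
  by apply: wf_ext; [exact: svalP | exact: svalP].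
by rewrite /= eqxx.
Qed.
Next Obligation.
move=> [Γ wΓ] [A wA] [Δ wΔ] [γ hγ] [t ht]; rewrite /= in wA hγ ht *.
exists (exist (fun s => has_sub Δ s (A :: Γ)) (t :: γ) (sub_ext hγ wA ht)) => /=.
have pr t' γ' : has_sub Δ γ' Γ ->
    sub_comp (id_sub (size Γ)) (t' :: γ') = γ'.
  move=> h; rewrite sub_comp_cons ?(has_sub_idl h) //.
  by rewrite (has_sub_size h); exact: closed_id_sub.
rewrite pr // (has_sub_size hγ) eqxx /= (sub_id _).1; split.
  by rewrite sub_ty_cons // (has_sub_size hγ); exact: wf_ty_scoped.
move=> [s hs] /= e [_ e'].
have [t' [γ' [es hγ' _]]] := has_sub_cons_inv hs.
move: e e'; rewrite es pr // => ->.
by rewrite /= (has_sub_size hγ) eqxx /= => ->.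
Qed.

Program Definition SynMCaTT_cat : Category :=
  {| obj := {Γ : mctx | mwf_ctx Γ};
     mor := fun Δ Γ => {γ : msub | mhas_sub (sval Δ) γ (sval Γ)};
     mor_eq := fun Δ Γ γ δ => meq_sub (sval Δ) (sval γ) (sval δ) (sval Γ);
     idc := fun Γ => exist _ (mid_sub (size (sval Γ))) (mhas_sub_id (svalP Γ));
     comp := fun Θ Δ Γ γ δ =>
       exist _ (msub_comp (sval γ) (sval δ))
         (mhas_sub_comp (svalP γ) (svalP δ)) |}.
Next Obligation.
move=> Δ Γ; split.
- by move=> [γ h]; exact: meq_sub_refl.
- by move=> γ δ; exact: meq_sub_sym.
- by move=> γ δ θ; exact: meq_sub_trans.
Qed.
Next Obligation.
by move=> Θ Δ Γ [γ h] [γ' h'] [δ k] [δ' k'] e e'; exact: meq_sub_comp e e'.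
Qed.
Next Obligation.
by move=> Δ Γ [γ h] /=; rewrite (mhas_sub_idl h); exact: meq_sub_refl.
Qed.
Next Obligation.
by move=> Δ Γ [γ h] /=; rewrite msub_comp_idr; exact: meq_sub_refl.
Qed.
Next Obligation.
move=> Ξ Θ Δ Γ [γ h] [δ h'] [θ h''] /=; rewrite (mhas_sub_compA h h' h'').
apply: meq_sub_refl; apply: (mhas_sub_comp h); exact: mhas_sub_comp h''.
Qed.

Program Definition SynMCaTT : CwF :=
  {| cwf_cat := SynMCaTT_cat;
     empty := exist _ [::] mwf_nil;
     Ty := fun Γ => {A : mty | mwf_ty (sval Γ) A};
     ty_eq := fun Γ A B => meq_ty (sval Γ) (sval A) (sval B);
     Tm := fun Γ A => {t : mtm | mhas_ty (sval Γ) t (sval A)};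
     tm_eq := fun Γ A B t u => meq_ty (sval Γ) (sval A) (sval B) /\
       meq_tm (sval Γ) (sval t) (sval u) (sval A);
     ty_sub := fun Γ Δ A γ =>
       exist _ (msub_ty (sval γ) (sval A)) (mwf_ty_sub (svalP γ) (svalP A));
     tm_sub := fun Γ Δ A t γ =>
       exist _ (msub_tm (sval γ) (sval t)) (mhas_ty_sub (svalP γ) (svalP t));
     extend := fun Γ A =>
       exist _ (sval A :: sval Γ) (mwf_ext (svalP Γ) (svalP A));
     display := fun Γ A =>
       exist _ (mid_sub (size (sval Γ))) (mhas_sub_proj (svalP A));
     generic := fun Γ A => exist _ (mvar (size (sval Γ))) _ |}.
Next Obligation.
case=> Γ wΓ /=; exists (exist (fun γ => mhas_sub Γ γ [::]) [::] (msub_nil wΓ)) => -[γ h] /=.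
by inversion_clear h; exact: meq_nil.
Qed.
Next Obligation.
move=> Γ; split.
- by move=> [A h]; exact: meq_ty_refl.
- by move=> A B; exact: meq_ty_sym.
- by move=> A B C; exact: meq_ty_trans.
Qed.
Next Obligation. by move=> Γ A B t u []. Qed.
Next Obligation.
by move=> Γ [A wA] [t ht] /=; split; [exact: meq_ty_refl | exact: meq_tm_refl].
Qed.
Next Obligation.
move=> Γ A B t u /= [e e']; split; first exact: meq_ty_sym.
by apply: meq_tm_conv e; exact: meq_tm_sym.
Qed.
Next Obligation.
move=> Γ A B C t u v /= [e1 e1'] [e2 e2']; split.
  exact: meq_ty_trans e1 e2.
by apply: meq_tm_trans e1' _; apply: meq_tm_conv e2' _; exact: meq_ty_sym.
Qed.
Next Obligation.
move=> Γ [A wA] [B wB] /= e [t ht]; exists (exist (fun t => mhas_ty (sval Γ) t B) t (mty_conv ht e)) => /=.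
by split => //; exact: meq_tm_refl.
Qed.
Next Obligation.
move=> Γ Δ [A wA] [B wB] [γ h] [δ h'] /= e e'.
apply: (@meq_ty_trans _ _ (msub_ty γ B)); first exact: meq_ty_sub e.
exact: mwf_ty_functional e'.
Qed.
Next Obligation.
by move=> Γ [A wA] /=; rewrite (msub_id _).1; exact: meq_ty_refl.
Qed.
Next Obligation.
move=> Γ Δ Θ [A wA] [γ h] [δ h'] /=.
rewrite -(msub_sub _ _).1 ?(mhas_sub_size h); last exact: mwf_ty_scoped.
by apply: meq_ty_refl; apply: (mwf_ty_sub h'); exact: (mwf_ty_sub h).
Qed.
Next Obligation.
move=> Γ Δ [A wA] [B wB] [t ht] [u hu] [γ h] [δ h'] /= [eA et] e; split.
  apply: (@meq_ty_trans _ _ (msub_ty γ B)); first exact: meq_ty_sub eA.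
  exact: mwf_ty_functional e.
apply: (@meq_tm_trans _ _ (msub_tm γ u)); first exact: meq_tm_sub et.
apply: (@meq_tm_conv _ _ _ (msub_ty γ B)).
  exact: mhas_ty_functional e.
by apply: (meq_ty_sub h); exact: meq_ty_sym.
Qed.
Next Obligation.
by move=> Γ [A wA] [t ht] /=; rewrite (msub_id _).1 (msub_id _).2; split;
  [exact: meq_ty_refl | exact: meq_tm_refl].
Qed.
Next Obligation.
move=> Γ Δ Θ [A wA] [t ht] [γ h] [δ h'] /=.
rewrite -(msub_sub _ _).1 -?(msub_sub _ _).2 ?(mhas_sub_size h).
- split.
    by apply: meq_ty_refl; apply: (mwf_ty_sub h'); exact: (mwf_ty_sub h).
  by apply: meq_tm_refl; apply: (mhas_ty_sub h'); exact: (mhas_ty_sub h).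
- exact: mhas_ty_scoped ht.
- exact: mwf_ty_scoped.
Qed.
Next Obligation.
move=> Γ A /=; rewrite (msub_id _).1; apply: mty_var.
  by apply: mwf_ext; [exact: svalP | exact: svalP].
by rewrite /= eqxx.
Qed.
Next Obligation.
move=> [Γ wΓ] [A wA] [Δ wΔ] [γ hγ] [t ht]; rewrite /= in wA hγ ht *.
exists (exist (fun s => mhas_sub Δ s (A :: Γ)) (t :: γ)
  (msub_ext hγ wA ht)) => /=.
have pr t' γ' : mhas_sub Δ γ' Γ ->
    msub_comp (mid_sub (size Γ)) (t' :: γ') = γ'.
  move=> h; rewrite msub_comp_cons ?(mhas_sub_idl h) //.
  by rewrite (mhas_sub_size h); exact: mclosed_mid_sub.
have cA t' γ' : mhas_sub Δ γ' Γ -> msub_ty (t' :: γ') A = msub_ty γ' A.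
  move=> h; rewrite msub_ty_cons // (mhas_sub_size h); exact: mwf_ty_scoped.
rewrite pr // (mhas_sub_size hγ) eqxx /= (msub_id _).1 cA //; split.
  split; first exact: meq_sub_refl.
  by split; [apply: meq_ty_refl; exact: mwf_ty_sub wA | exact: meq_tm_refl].
move=> [s hs] /= e [_ e'].
have [t' [γ' [es hγ' ht']]] := mhas_sub_cons_inv hs.
move: e e'; rewrite es pr // cA // /= (mhas_sub_size hγ') eqxx /= => e e'.
exact: meq_ext.
Qed.

Lemma des_sub_id n : des_sub (id_sub n) = mid_sub n.
Proof. by elim: n => //= n ->. Qed.

Lemma des_sub_comp γ δ :
  des_sub (sub_comp γ δ) = msub_comp (des_sub γ) (des_sub δ).
Proof.
by rewrite /des_sub /sub_comp /msub_comp -!map_comp; apply: eq_map => t;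
  rewrite /= (des_sub_raw _).2.
Qed.

Program Definition Desuspension : Functor SynCaTT SynMCaTT :=
  @Build_Functor SynCaTT SynMCaTT
    (fun Γ => exist _ (des_ctx (sval Γ)) (des_wf_ctx (svalP Γ)))
    (fun Δ Γ γ => exist _ (des_sub (sval γ)) (des_has_sub (svalP γ)))
    _ _ _.
Next Obligation.
by move=> Δ Γ [γ h] δ /= <-; apply: meq_sub_refl; exact: des_has_sub.
Qed.
Next Obligation.
move=> [Γ wΓ] /=; rewrite des_sub_id -(size_des_ctx Γ).
by apply: meq_sub_refl; apply: mhas_sub_id; exact: des_wf_ctx.
Qed.
Next Obligation.
move=> Θ Δ Γ [γ h] [δ h'] /=; rewrite des_sub_comp; apply: meq_sub_refl.
by apply: mhas_sub_comp; apply: des_has_sub; eassumption.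
Qed.

Program Definition ReducedSuspension : Functor SynMCaTT SynCaTT :=
  @Build_Functor SynMCaTT SynCaTT
    (fun Γ => exist _ (sus_ctx (sval Γ)) (sus_typed.1 _ (svalP Γ)))
    (fun Δ Γ γ => exist _ (sus_sub (sval Δ) (sval Γ) (sval γ))
                   (sus_sub_typed (svalP γ)))
    _ _ _.
Next Obligation. by move=> Δ Γ γ δ; exact: sus_sub_proper. Qed.
Next Obligation. by move=> Γ; exact: sus_sub_id. Qed.
Next Obligation.
by move=> Θ Δ Γ [γ h] [δ h']; exact: sus_sub_comp.
Qed.

(** The 0-disk [D^0 = (x : star)]. *)
Definition disk0 : SynCaTT :=
  exist _ [:: star] (wf_ext wf_nil (wf_star wf_nil)).

Definition one_object (F : Mod SynCaTT) : Prop :=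
  is_singleton (fobj (sval F) disk0).

Definition PointedMod : Category := FullSub one_object.

Definition precomp_models (C D : CwF) (K : Functor C D) :
    Functor (Mod D) (FunCat C SetCat) :=
  comp_functor (precomp SetCat K) (@inclusion (FunCat D SetCat) (@is_model D)).

(* Main.v *)
(** The functors [Desuspension] and [ReducedSuspension] are related by natural
    transformations [unsuspension : D Σ_r Γ → Γ] and [bullet_nat : Σ_r D Θ → Θ].
    The first is invertible already in the syntax of MCaTT, because the
    η-rule identifies every term of the unit type with [mtt].  The second is not
    invertible, but a model [F] with [F D^0] a singleton inverts it: extending [Θ]
    by a variable of type [star] does not change [F Θ], and for any other
    extension [bullet] is the pullback of the [bullet] of the smaller context
    along a display map.  Composing models with the two functors gives models
    because both send a display map either to an isomorphism or to a display
    map. *)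

From mathcomp Require Import all_boot.
From Stdlib Require Import RelationClasses Morphisms Setoid.
From Stdlib Require Import IndefiniteDescription.
Require Import Defs.

Set Implicit Arguments.
Unset Strict Implicit.
Unset Printing Implicit Defensive.
Local Open Scope cat_scope.
#[local] Obligation Tactic := idtac.

(** * Isomorphisms and pullbacks *)

#[local] Hint Extern 0 (_ ≈ _) => reflexivity : core.

Section Isomorphisms.
Variable C : Category.
Implicit Types X Y Z : C.

Lemma is_iso_id X : is_iso (idc X).
Proof. by exists (idc X); split; exact: comp_idl. Qed.

Lemma is_iso_cancel_l X Y Z (f : mor X Y) (g : mor Y Z) :
  is_iso g -> is_iso (g ⊚ f) -> is_iso f.
Proof.
move=> [g' [g'g gg']] [h [hgf gfh]]; exists (h ⊚ g); split.
  by rewrite -comp_assoc.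
have e : f ⊚ h ≈ g'.
  rewrite -(comp_idl (f ⊚ h)) -g'g -comp_assoc (comp_assoc g f h) gfh.
  exact: comp_idr.
by rewrite comp_assoc e.
Qed.

Lemma is_iso_comp X Y Z (f : mor X Y) (g : mor Y Z) :
  is_iso g -> is_iso f -> is_iso (g ⊚ f).
Proof.
move=> [g' [g'g gg']] [f' [f'f ff']]; exists (f' ⊚ g'); split.
  by rewrite -comp_assoc (comp_assoc g' g f) g'g comp_idl.
by rewrite -comp_assoc (comp_assoc f f' g') ff' comp_idl.
Qed.

Lemma is_iso_eq X Y (f g : mor X Y) : f ≈ g -> is_iso f -> is_iso g.
Proof. by move=> e [f' [e1 e2]]; exists f'; rewrite -e. Qed.

Lemma is_iso_terminal X Y (f : mor X Y) :
  is_terminal X -> is_terminal Y -> is_iso f.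
Proof.
move=> tX tY; have [g _] := tX Y; exists g.
have [i ei] := tX X; have [j ej] := tY Y.
by split; [rewrite (ei (g ⊚ f)) (ei (idc X)) | rewrite (ej (f ⊚ g)) (ej (idc Y))].
Qed.

Lemma terminal_iso X Y (f : mor X Y) :
  is_iso f -> is_terminal Y -> is_terminal X.
Proof.
move=> [g [gf fg]] tY W; have [h eh] := tY W; exists (g ⊚ h) => k.
by rewrite -(comp_idl k) -gf -comp_assoc (eh (f ⊚ k)).
Qed.

End Isomorphisms.

Lemma fmor_iso (C D : Category) (F : Functor C D) (X Y : C) (f : mor X Y) :
  is_iso f -> is_iso (fmor F f).
Proof.
move=> [g [gf fg]]; exists (fmor F g); rewrite -!fmor_comp.
by split; rewrite -fmor_id; exact: fmor_proper.
Qed.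

Section Pullbacks.
Variables (C : Category) (P X Y Z : C).
Variables (a : mor P X) (b : mor P Y) (f : mor X Z) (g : mor Y Z).

Lemma pullback_sym : is_pullback a b f g -> is_pullback b a g f.
Proof.
move=> [sq univ]; split=> [|W u v e]; first by symmetry.
have [w [[aw bw] uw]] := univ W v u (symmetry e).
by exists w; split=> // w' bw' aw'; exact: uw.
Qed.

Lemma pullback_unique (P' : C) (a' : mor P' X) (b' : mor P' Y) :
  is_pullback a b f g -> is_pullback a' b' f g ->
  exists h : mor P' P, [/\ is_iso h, a ⊚ h ≈ a' & b ⊚ h ≈ b'].
Proof.
move=> [sq univ] [sq' univ'].
have [h [[ah bh] _]] := univ _ _ _ sq'.
have [k [[a'k b'k] _]] := univ' _ _ _ sq.
exists h; split=> //; exists k; split.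
- have [i [_ ui]] := univ' _ _ _ sq'.
  rewrite (ui (k ⊚ h)) ?comp_assoc ?a'k ?b'k //.
  by symmetry; apply: ui; exact: comp_idr.
- have [i [_ ui]] := univ _ _ _ sq.
  rewrite (ui (h ⊚ k)) ?comp_assoc ?ah ?bh //.
  by symmetry; apply: ui; exact: comp_idr.
Qed.

Lemma pullback_iso_apex (P' : C) (h : mor P' P) (a' : mor P' X) (b' : mor P' Y) :
  is_iso h -> a ⊚ h ≈ a' -> b ⊚ h ≈ b' ->
  is_pullback a b f g -> is_pullback a' b' f g.
Proof.
move=> [k [kh hk]] ea eb [sq univ]; split=> [|W u v e].
  by rewrite -ea -eb !comp_assoc sq.
have [w [[aw bw] uw]] := univ _ _ _ e; exists (k ⊚ w); split.
  rewrite -ea -eb -!comp_assoc !(comp_assoc h k w) hk comp_idl.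
  by split.
move=> w' e1 e2; rewrite -(uw (h ⊚ w')) ?comp_assoc ?ea ?eb //.
by rewrite kh comp_idl.
Qed.

Lemma pullback_slice_iso (X' : C) (e : mor X X') (f' : mor X' Z) :
  is_iso e -> f' ⊚ e ≈ f ->
  is_pullback a b f g <-> is_pullback (e ⊚ a) b f' g.
Proof.
move=> [d [de ed]] ef; split=> [[sq univ]|[sq univ]]; split.
- by rewrite comp_assoc ef.
- move=> W u v e'; have [|w [[aw bw] uw]] := univ W (d ⊚ u) v.
    by rewrite -ef -comp_assoc (comp_assoc e d u) ed comp_idl.
  exists w; split=> [|w' e1 e2].
    by rewrite -comp_assoc aw comp_assoc ed comp_idl.
  by apply: uw => //; rewrite -e1 !comp_assoc de comp_idl.
- by rewrite -ef -comp_assoc.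
- move=> W u v e'; have [|w [[aw bw] uw]] := univ W (e ⊚ u) v.
    by rewrite comp_assoc ef.
  exists w; split=> [|w' e1 e2].
    split=> //; rewrite -(comp_idl (a ⊚ w)) -de -comp_assoc (comp_assoc e a w) aw.
    by rewrite comp_assoc de comp_idl.
  by apply: uw => //; rewrite -comp_assoc e1.
Qed.

Lemma pullback_of_iso : is_iso f -> is_pullback a b f g -> is_iso b.
Proof.
move=> [f' [f'f ff']] [sq univ].
have [|s [[as_ bs] _]] := univ Y (f' ⊚ g) (idc Y).
  by rewrite comp_assoc ff' comp_idl comp_idr.
exists s; split=> //; have [i [_ ui]] := univ _ _ _ sq.
rewrite (ui (s ⊚ b)).
- by symmetry; apply: ui; exact: comp_idr.
- by rewrite comp_assoc as_ -comp_assoc -sq comp_assoc f'f comp_idl.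
- by rewrite comp_assoc bs comp_idl.
Qed.

Lemma pullback_isos : is_iso f -> is_iso b -> f ⊚ a ≈ g ⊚ b ->
  is_pullback a b f g.
Proof.
move=> [f' [f'f ff']] [c [cb bc]] sq; split=> // W u v e.
exists (c ⊚ v); split=> [|w' _ bw].
  split; last by rewrite comp_assoc bc comp_idl.
  rewrite -(comp_idl (a ⊚ _)) -f'f -comp_assoc (comp_assoc f a) sq.
  by rewrite -(comp_assoc g b) (comp_assoc b c) bc comp_idl -e comp_assoc f'f comp_idl.
by rewrite -bw comp_assoc cb comp_idl.
Qed.

End Pullbacks.

Lemma pullback_preserved_of_one (C D : Category) (K : Functor C D)
    (P P' X Y Z : C) (a : mor P X) (b : mor P Y) (f : mor X Z) (g : mor Y Z)
    (a' : mor P' X) (b' : mor P' Y) :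
  is_pullback a b f g -> is_pullback a' b' f g ->
  is_pullback (fmor K a) (fmor K b) (fmor K f) (fmor K g) ->
  is_pullback (fmor K a') (fmor K b') (fmor K f) (fmor K g).
Proof.
move=> p p' Kp; have [h [ih ah bh]] := pullback_unique p p'.
apply: (pullback_iso_apex (h := fmor K h)) Kp; first exact: fmor_iso.
- by rewrite -(fmor_comp K); exact: fmor_proper.
- by rewrite -(fmor_comp K); exact: fmor_proper.
Qed.

Lemma display_pullback_preserved (C : CwF) (E : Category) (F : Functor C E)
    (P X Y Z : C) (B : Ty Z) (e : mor X (extend B))
    (a : mor P X) (b : mor P Y) (f : mor X Z) (g : mor Y Z) :
  preserves_display_pullbacks F -> is_iso e -> display B ⊚ e ≈ f ->
  is_pullback a b f g ->
  is_pullback (fmor F a) (fmor F b) (fmor F f) (fmor F g).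
Proof.
move=> pF ie ef /(pullback_slice_iso _ _ _ ie ef) /pF p.
have eF : fmor F (display B) ⊚ fmor F e ≈ fmor F f.
  by rewrite -(fmor_comp F); exact: fmor_proper.
apply/(pullback_slice_iso _ _ _ (fmor_iso F ie) eF).
apply: pullback_iso_apex p; first exact: is_iso_id.
- by rewrite comp_idr fmor_comp.
- exact: comp_idr.
Qed.

Lemma pullback_of_iso_preserved (C D : Category) (K : Functor C D)
    (P X Y Z : C) (a : mor P X) (b : mor P Y) (f : mor X Z) (g : mor Y Z) :
  is_iso f -> is_pullback a b f g ->
  is_pullback (fmor K a) (fmor K b) (fmor K f) (fmor K g).
Proof.
move=> fi p; apply: pullback_isos; first exact: fmor_iso.
  by apply: fmor_iso; exact: pullback_of_iso p.
by rewrite -!fmor_comp; apply: fmor_proper; case: p.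
Qed.

Lemma is_terminal_SetCat (T : SetCat) : is_terminal T <-> is_singleton T.
Proof.
split=> [t|[x ux] X].
  have [f uf] := t (unit : SetCat); exists (f tt) => y.
  exact: (uf (fun=> y)).
by exists (fun=> x) => g y; exact: ux.
Qed.

Lemma FunCat_is_iso (C D : Category) (F G : FunCat C D) (a : mor F G) :
  (forall X, is_iso (component a X)) -> is_iso a.
Proof.
move=> ia; pose b X := constructive_indefinite_description _ (ia X).
have [inv invP] : exists inv : forall X, mor (G X) (F X), forall X,
    inv X ⊚ component a X ≈ idc (F X) /\ component a X ⊚ inv X ≈ idc (G X).
  by exists (fun X => sval (b X)) => X; exact: svalP (b X).
have nat X Y (f : mor X Y) : fmor F f ⊚ inv X ≈ inv Y ⊚ fmor G f.
  rewrite -(comp_idl (fmor F f ⊚ inv X)) -(invP Y).1 -comp_assoc.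
  rewrite (comp_assoc (component a Y)) -(naturality a f).
  by rewrite -(comp_assoc _ (component a X)) (invP X).2 comp_idr.
exists (Build_NatTrans nat : mor G F).
by split=> X; [exact: (invP X).1 | exact: (invP X).2].
Qed.

Section Counit.
Variables (C D : Category) (K : Functor C D) (L : Functor D C).
Variables (k : NatTrans (comp_functor L K) (id_functor C)).

Program Definition precomp_counit (E : Category) (F : FunCat C E) :
    mor (comp_functor (comp_functor F L) K : FunCat C E) F :=
  {| component := fun X => fmor F (k X) |}.
Next Obligation.
move=> E F X Y f.
by rewrite /= -!(fmor_comp F); apply: fmor_proper; exact: (naturality k).
Qed.

Lemma precomp_counit_natural (E : Category) (F G : FunCat C E) (a : mor F G) X :
  component a X ⊚ component (precomp_counit F) X
  ≈ component (precomp_counit G) X ⊚ component a (L (K X)).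
Proof. by symmetry; exact: (naturality a). Qed.

End Counit.

(** * Display pullbacks in the syntactic categories *)

Lemma has_sub_proj_cons Δ t γ Γ :
  has_sub Δ γ Γ -> sub_comp (id_sub (size Γ)) (t :: γ) = γ.
Proof.
move=> h; rewrite sub_comp_cons ?(has_sub_idl h) //.
by rewrite (has_sub_size h); exact: closed_id_sub.
Qed.

Lemma mhas_sub_proj_cons Δ t γ Γ :
  mhas_sub Δ γ Γ -> msub_comp (mid_sub (size Γ)) (t :: γ) = γ.
Proof.
move=> h; rewrite msub_comp_cons ?(mhas_sub_idl h) //.
by rewrite (mhas_sub_size h); exact: mclosed_mid_sub.
Qed.

(** The contexts [P] and [X] are extensions only up to the proofs that they are
    well-formed: the functors preserve extension only in this sense. *)
Lemma catt_canonical_pullback (P X Y Z : SynCaTT) (a : mor P X) (b : mor P Y)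
    (f : mor X Z) (g : mor Y Z) (A : ty) :
  sval X = A :: sval Z -> sval P = sub_ty (sval g) A :: sval Y ->
  sval a = var (size (sval Y)) :: sval g -> sval b = id_sub (size (sval Y)) ->
  sval f = id_sub (size (sval Z)) -> is_pullback a b f g.
Proof.
case: P X Y Z a b f g => [P wP] [X wX] [Y wY] [Z wZ].
case=> [a ha] [b hb] [f hf] [g hg] /= eX eP ea eb ef; subst.
have wA : wf_ty Z A by inversion_clear wX.
have wA' : wf_ty Y (sub_ty g A) by inversion_clear wP.
split; first by rewrite /= (has_sub_proj_cons _ hg) sub_comp_idr.
move=> [W wW] [u hu] [v hv] /= e.
have [t [u' [eu hu' ht]]] := has_sub_cons_inv hu; subst u.
rewrite (has_sub_proj_cons _ hu') in e; subst u'.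
have hw : has_sub W (t :: v) (sub_ty g A :: Y).
  apply: sub_ext => //; rewrite (sub_sub _ _).1 //.
  by rewrite (has_sub_size hg); exact: wf_ty_scoped.
exists (exist _ (t :: v) hw) => /=; rewrite (has_sub_proj_cons _ hv).
rewrite (has_sub_size hv) eqxx /=; split.
  split=> //; congr (_ :: _); apply: sub_comp_cons.
  by rewrite (has_sub_size hv); exact: has_sub_scoped hg.
move=> [w hw'] /=; have [t' [v' [ew hv' _]]] := has_sub_cons_inv hw'; subst w.
by rewrite (has_sub_proj_cons _ hv') /= (has_sub_size hv') eqxx /= => -[-> _] ->.
Qed.

Lemma mcatt_canonical_pullback (P X Y Z : SynMCaTT) (a : mor P X) (b : mor P Y)
    (f : mor X Z) (g : mor Y Z) (A : mty) :
  sval X = A :: sval Z -> sval P = msub_ty (sval g) A :: sval Y ->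
  sval a = mvar (size (sval Y)) :: sval g -> sval b = mid_sub (size (sval Y)) ->
  sval f = mid_sub (size (sval Z)) -> is_pullback a b f g.
Proof.
case: P X Y Z a b f g => [P wP] [X wX] [Y wY] [Z wZ].
case=> [a ha] [b hb] [f hf] [g hg] /= eX eP ea eb ef; subst.
have wA : mwf_ty Z A by inversion_clear wX.
have wA' : mwf_ty Y (msub_ty g A) by inversion_clear wP.
split.
  rewrite /= (mhas_sub_proj_cons _ hg) msub_comp_idr.
  by apply: meq_sub_refl; exact: mhas_sub_weaken.
move=> [W wW] [u hu] [v hv] /= e.
have [t [u' [eu hu' ht]]] := mhas_sub_cons_inv hu; subst u.
rewrite (mhas_sub_proj_cons _ hu') in e.
have hgv := mhas_sub_comp hg hv.
have eA : msub_ty v (msub_ty g A) = msub_ty (msub_comp g v) A.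
  rewrite (msub_sub _ _).1 //.
  by rewrite (mhas_sub_size hg); exact: mwf_ty_scoped.
have ht' : mhas_ty W t (msub_ty v (msub_ty g A)).
  by rewrite eA; apply: mty_conv ht _; exact: mwf_ty_functional e.
have hw : mhas_sub W (t :: v) (msub_ty g A :: Y) by exact: msub_ext.
have wk t' v' : mhas_sub W v' Y -> msub_comp g (t' :: v') = msub_comp g v'.
  move=> h; apply: msub_comp_cons.
  by rewrite (mhas_sub_size h); exact: mhas_sub_scoped hg.
exists (exist _ (t :: v) hw) => /=; rewrite (mhas_sub_proj_cons _ hv).
rewrite (mhas_sub_size hv) eqxx /= wk //; split.
  split; last exact: meq_sub_refl.
  apply: meq_ext => //; first exact: meq_sub_sym.
  by rewrite -eA; exact: meq_tm_refl.
move=> [w hw'] /=; have [t' [v' [ew hv' _]]] := mhas_sub_cons_inv hw'; subst w.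
rewrite (mhas_sub_proj_cons _ hv') /= (mhas_sub_size hv') eqxx /= wk //.
move=> /meq_sub_cons_inv [_ [_ [_ [_ [[<- <-] [<- <-] _ et]]]]] ev.
apply: meq_ext => //.
by rewrite (msub_sub _ _).1 // (mhas_sub_size hg); exact: mwf_ty_scoped.
Qed.

Lemma catt_recast_is_iso (X Y : SynCaTT) (f : mor X Y) :
  sval X = sval Y -> sval f = id_sub (size (sval Y)) -> is_iso f.
Proof.
case: X Y f => [X wX] [Y wY] [f hf] /= e ef; subst.
by exists (exist (fun γ => has_sub Y γ Y) _ (has_sub_id wX)); split; exact: sub_comp_idr.
Qed.

Lemma catt_recast (X Y : SynCaTT) :
  sval X = sval Y -> exists f : mor X Y, sval f = id_sub (size (sval Y)).
Proof.
case: X Y => [X wX] [Y wY] /= e; subst.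
by exists (exist (fun γ => has_sub Y γ Y) _ (has_sub_id wX)).
Qed.

Lemma mcatt_recast_is_iso (X Y : SynMCaTT) (f : mor X Y) :
  sval X = sval Y -> sval f = mid_sub (size (sval Y)) -> is_iso f.
Proof.
case: X Y f => [X wX] [Y wY] [f hf] /= e ef; subst.
exists (exist (fun γ => mhas_sub Y γ Y) _ hf).
by split; rewrite /= msub_comp_idr; exact: meq_sub_refl.
Qed.

Lemma mcatt_recast (X Y : SynMCaTT) :
  sval X = sval Y -> exists f : mor X Y, sval f = mid_sub (size (sval Y)).
Proof.
case: X Y => [X wX] [Y wY] /= e; subst.
by exists (exist (fun γ => mhas_sub Y γ Y) _ (mhas_sub_id wX)).
Qed.

Lemma mcatt_eq_mor (X Y : SynMCaTT) (f g : mor X Y) : sval f = sval g -> f ≈ g.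
Proof. by case: f g => [f hf] [g hg] /= <-; exact: meq_sub_refl. Qed.

(** * Models restricted along the two functors *)

Lemma preserves_terminal_of_empty (C : CwF) (E : Category) (F : Functor C E) :
  is_terminal (F (empty C)) -> preserves_terminal F.
Proof.
move=> tF T tT; have [f _] := empty_terminal (c := C) T.
apply: (terminal_iso (f := fmor F f)) tF; apply: fmor_iso.
by apply: is_iso_terminal => //; exact: empty_terminal.
Qed.

Lemma mcatt_units_terminal (T : SynMCaTT) :
  all (fun A => ~~ nonunit A) (sval T) -> is_terminal T.
Proof.
case: T => [T wT] /= uT [X wX].
have [f hf] : exists f, mhas_sub X f T.
  elim: T wT uT => [|A T IH] wT /=; first by exists [::]; exact: msub_nil.
  case: A wT => // wT uT; inversion_clear wT as [|? ? wT' wA].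
  have [f hf] := IH wT' uT; exists (mtt :: f); apply: msub_ext => //.
  exact: mty_tt.
suff uf g : mhas_sub X g T -> meq_sub X g f T.
  by exists (exist (fun γ => mhas_sub X γ T) _ hf) => -[g hg]; exact: uf.
elim: hf g uT => {X wX f T wT} [Δ _|Δ f T A t hf IH wA ht] g /= uT hg.
  by inversion_clear hg; exact: meq_nil.
have [t' [g' [-> hg' ht']]] := mhas_sub_cons_inv hg.
case: A wA ht ht' {hg} uT => //= wA ht ht' uT.
apply: meq_ext => //; first exact: IH.
apply: meq_tm_trans (meq_eta ht') _; exact: meq_tm_sym (meq_eta ht).
Qed.

Lemma desuspension_model (F : Functor SynMCaTT SetCat) :
  is_model F -> is_model (C := SynCaTT) (comp_functor F Desuspension).
Proof.
move=> [tF pF]; split.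
  by apply: preserves_terminal_of_empty; apply: tF; exact: mcatt_units_terminal.
move=> Γ A Δ P γ a b p.
pose A' : Ty (c := SynMCaTT) (Desuspension Γ) :=
  exist (mwf_ty (des_ctx (sval Γ))) (des_ty (sval A)) (des_wf_ty (svalP A)).
have [e ee] := mcatt_recast (X := Desuspension (extend A)) (Y := extend A') erefl.
have ie : is_iso e by exact: mcatt_recast_is_iso ee.
apply: (display_pullback_preserved (a := fmor Desuspension a)
  (b := fmor Desuspension b) (f := fmor Desuspension (display A))
  (g := fmor Desuspension γ) pF ie).
  apply: mcatt_eq_mor; rewrite /= ee msub_comp_idr /= des_sub_id.
  by rewrite size_des_ctx.
pose P' : SynCaTT := extend (ty_sub A γ).
have hg := has_sub_weaken (svalP P') (svalP γ).
have wA := wf_ty_sub (svalP γ) (svalP A).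
have hv : has_ty (sval P') (var (size (sval Δ))) (sub_ty (sval γ) (sval A)).
  by apply: ty_var; [exact: svalP | rewrite /= eqxx].
pose a' : mor P' (extend A) :=
  exist (fun θ => has_sub (sval P') θ (sval (extend A)))
    (var (size (sval Δ)) :: sval γ) (sub_ext hg (svalP A) hv).
have p' : is_pullback a' (display (ty_sub A γ)) (display A) γ.
  exact: (@catt_canonical_pullback _ _ _ _ _ _ _ _ (sval A)).
apply: (pullback_preserved_of_one (K := Desuspension) p' p).
apply: (@mcatt_canonical_pullback _ _ _ _ _ _ _ _ (des_ty (sval A))) => //=.
- by rewrite (des_sub_raw _).1.
- by rewrite size_des_ctx.
- by rewrite des_sub_id size_des_ctx.
- by rewrite des_sub_id size_des_ctx.
Qed.

Lemma desuspension_disk0_terminal : is_terminal (Desuspension disk0).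
Proof. exact: mcatt_units_terminal. Qed.

Lemma sus_tm_cons a (ρ : sub) t :
  below (size ρ) (mvars_tm t) -> sus_tm (a :: ρ) t = sus_tm ρ t.
Proof.
by move=> /allP cl; apply: (sus_agree _ _).2 => i /cl lt; exact: lookup_cons_lt.
Qed.

Lemma sus_sub_weaken A Δ Γ γ : mclosed_sub (size Δ) γ ->
  sus_sub (A :: Δ) Γ γ = sus_sub Δ Γ γ.
Proof.
move=> cl; rewrite /sus_sub; congr sus_entries; elim: γ cl => //= t γ IH.
by move=> /andP[ct /IH ->]; rewrite sus_tm_cons // size_sus_vars.
Qed.

Lemma nonunit_msub γ A : nonunit (msub_ty γ A) = nonunit A.
Proof. by case: A. Qed.

Lemma mcatt_display_unit_is_iso (Γ : SynMCaTT) (A : Ty Γ) :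
  ~~ nonunit (sval A) -> is_iso (display A).
Proof.
case: Γ A => [Γ wΓ] [[|A t u] wA] // _.
have h : mhas_sub Γ (mtt :: mid_sub (size Γ)) (munit :: Γ).
  by apply: msub_ext => //; [exact: mhas_sub_id | exact: mty_tt].
exists (exist (fun γ => mhas_sub Γ γ (munit :: Γ)) _ h); split=> /=; last first.
  rewrite (mhas_sub_proj_cons _ (mhas_sub_id wΓ)).
  by apply: meq_sub_refl; exact: mhas_sub_id.
rewrite msub_comp_idr; apply: meq_ext => //.
  by apply: meq_sub_refl; exact: mhas_sub_proj.
apply: meq_tm_sym; apply: meq_eta; apply: mty_var; first exact: mwf_ext.
by rewrite /= eqxx.
Qed.

Lemma suspension_model (F : Functor SynCaTT SetCat) :
  is_model F -> is_singleton (F disk0) ->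
  is_model (C := SynMCaTT) (comp_functor F ReducedSuspension).
Proof.
move=> [tF pF] sF; split.
  apply: preserves_terminal_of_empty.
  have [e ee] := catt_recast (X := ReducedSuspension (empty SynMCaTT))
    (Y := disk0) erefl.
  have ie : is_iso e by exact: catt_recast_is_iso ee.
  by apply: (terminal_iso (fmor_iso F ie)); exact/is_terminal_SetCat.
move=> Γ A Δ P γ a b p.
have [uA|/mcatt_display_unit_is_iso iA] := boolP (nonunit (sval A)); last first.
  exact: (pullback_of_iso_preserved (comp_functor F ReducedSuspension) iA p).
pose A' : Ty (c := SynCaTT) (ReducedSuspension Γ) :=
  exist (wf_ty (sus_ctx (sval Γ))) _ (sus_typed.2.1 _ _ (svalP A)).
have eX : sval (ReducedSuspension (extend A)) = sval (extend A').
  by rewrite /= uA.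
have wkid (Δ' : SynMCaTT) (B : Ty Δ') :
    sus_sub (sval B :: sval Δ') (sval Δ') (mid_sub (size (sval Δ'))) =
    id_sub (size (sus_ctx (sval Δ'))).
  by rewrite sus_sub_weaken ?sus_sub_id //; exact: mclosed_mid_sub.
have [e ee] := catt_recast eX.
have ie : is_iso e by exact: catt_recast_is_iso ee.
apply: (display_pullback_preserved (a := fmor ReducedSuspension a)
  (b := fmor ReducedSuspension b) (f := fmor ReducedSuspension (display A))
  (g := fmor ReducedSuspension γ) pF ie).
  by rewrite /= ee sub_comp_idr wkid.
pose P' : SynMCaTT := extend (ty_sub A γ).
have hg := mhas_sub_weaken (svalP P') (svalP γ).
have wA := mwf_ty_sub (svalP γ) (svalP A).
have hv : mhas_ty (sval P') (mvar (size (sval Δ))) (msub_ty (sval γ) (sval A)).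
  by apply: mty_var; [exact: svalP | rewrite /= eqxx].
pose a' : mor P' (extend A) :=
  exist (fun θ => mhas_sub (sval P') θ (sval (extend A)))
    (mvar (size (sval Δ)) :: sval γ) (msub_ext hg (svalP A) hv).
have p' : is_pullback a' (display (ty_sub A γ)) (display A) γ.
  exact: (@mcatt_canonical_pullback _ _ _ _ _ _ _ _ (sval A)).
apply: (pullback_preserved_of_one (K := ReducedSuspension) p' p).
apply: (@catt_canonical_pullback _ _ _ _ _ _ _ _ (sval A')) => //=.
- by rewrite nonunit_msub uA (sus_subst.2.1 _ _ (svalP A) _ _ (svalP γ)).
- rewrite /sus_sub /= sus_entries_cons uA size_sus_vars eqxx /= nonunit_msub uA.
  rewrite size_sus_ctx; congr (_ :: _).
  have := sus_sub_weaken (msub_ty (sval γ) (sval A)) (sval Γ)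
    (mhas_sub_scoped (svalP γ)).
  by rewrite /sus_sub /= nonunit_msub uA.
- exact: (wkid _ (ty_sub A γ)).
Qed.

(** * The unit-type variables are redundant in MCaTT *)

Notation des_sus Γ := (des_ctx (sus_ctx Γ)).
Notation unsus Γ := (des_sub (sus_vars Γ)).

Lemma mwf_des_sus Γ : mwf_ctx Γ -> mwf_ctx (des_sus Γ).
Proof. by move=> /sus_typed.1; exact: des_wf_ctx. Qed.

Lemma mcatt_unsus :
  (forall Γ, mwf_ctx Γ -> mhas_sub (des_sus Γ) (unsus Γ) Γ) /\
  (forall Γ A, mwf_ty Γ A -> mhas_sub (des_sus Γ) (unsus Γ) Γ /\
     meq_ty (des_sus Γ) (des_ty (sus_ty (sus_vars Γ) A)) (msub_ty (unsus Γ) A)) /\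
  (forall Γ t A, mhas_ty Γ t A -> mhas_sub (des_sus Γ) (unsus Γ) Γ /\
     meq_tm (des_sus Γ) (des_tm (sus_tm (sus_vars Γ) t)) (msub_tm (unsus Γ) t)
       (msub_ty (unsus Γ) A)) /\
  (forall Δ γ Γ, mhas_sub Δ γ Γ -> mhas_sub (des_sus Δ) (unsus Δ) Δ /\
     meq_sub (des_sus Δ) (des_sub (map (sus_tm (sus_vars Δ)) γ))
       (msub_comp γ (unsus Δ)) Γ) /\
  (forall Γ A B, meq_ty Γ A B -> True) /\
  (forall Γ t u A, meq_tm Γ t u A -> True) /\
  (forall Δ γ δ Γ, meq_sub Δ γ δ Γ -> True).
Proof.
apply: mcatt_mut => //.
- by apply: msub_nil; exact: mwf_des_sus mwf_nil.
- move=> Γ A wΓ hΓ wA [_ eA].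
  have := mwf_des_sus (mwf_ext wΓ wA); case: A wA eA => [|A t u] wA eA wS.
    apply: msub_ext => //; apply: mty_var; first exact: wS.
    by rewrite lookup_map lookup_sus_ctx0.
  apply: msub_ext => //; first exact: mhas_sub_weaken wS hΓ.
  apply: mty_conv; last exact: mcatt_weaken.2.2.2.2.1 eA _ wS.
  by apply: mty_var => //=; rewrite size_des_ctx size_sus_ctx eqxx.
- move=> Γ wΓ hΓ; split=> //.
  by apply: meq_ty_refl; apply: mwf_unit; exact: mwf_des_sus.
- by move=> Γ A t u _ [hΓ eA] _ [_ et] _ [_ eu]; split=> //; apply: meq_hom => //;
    apply: meq_tm_conv (meq_ty_sym eA).
- move=> Γ i A wΓ hΓ lk; split=> //.
  suff -> : des_tm (sus_tm (sus_vars Γ) (mvar i)) = msub_tm (unsus Γ) (mvar i).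
    by apply: meq_tm_refl; exact: mhas_sub_lookup lk.
  rewrite /= lookup_map; case: (@lookup_some _ (sus_vars Γ) i) => [|v -> //].
  by rewrite size_sus_vars; exact: lookup_lt lk.
- move=> Γ wΓ hΓ; split=> //; apply: meq_eta; apply: mty_var.
    exact: mwf_des_sus.
  by rewrite lookup_map lookup_sus_ctx0.
- move=> Δ Θ A γ oA hγ [hΔ e]; split=> //; have wA := op_ty_wf oA.
  rewrite /= (sub_comp_sus_vars (sus_units_collapse hγ)).
  rewrite (msub_sub _ _).1; last by rewrite (mhas_sub_size hγ) des_ty_scoped.
  apply: meq_tm_conv; first exact: meq_op oA e.
  apply: (mwf_ty_functional (des_wf_ty wA) _ e).
  exact: (mcatt_presup.2.2.2.2.2.2 _ _ _ _ e).1.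
- move=> Δ Θ A γ oA hγ [hΔ e]; split=> //; have wA := coh_ty_wf oA.
  rewrite /= (sub_comp_sus_vars (sus_units_collapse hγ)).
  rewrite (msub_sub _ _).1; last by rewrite (mhas_sub_size hγ) des_ty_scoped.
  apply: meq_tm_conv; first exact: meq_coh oA e.
  apply: (mwf_ty_functional (des_wf_ty wA) _ e).
  exact: (mcatt_presup.2.2.2.2.2.2 _ _ _ _ e).1.
- move=> Γ t A B _ [hΓ et] eAB _; split=> //.
  by apply: meq_tm_conv et _; exact: meq_ty_sub eAB.
- by move=> Δ wΔ hΔ; split=> //; apply: meq_nil; exact: mwf_des_sus.
- move=> Δ γ Γ A t hγ [hΔ e] wA _ ht [_ et]; split=> //; apply: meq_ext => //.
  apply: meq_tm_conv et _.
  rewrite (msub_sub _ _).1; last by rewrite (mhas_sub_size hγ) mwf_ty_scoped.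
  apply: meq_ty_sym; apply: (mwf_ty_functional wA _ e).
  exact: (mcatt_presup.2.2.2.2.2.2 _ _ _ _ e).1.
Qed.

Lemma unsus_typed Γ : mwf_ctx Γ -> mhas_sub (des_sus Γ) (unsus Γ) Γ.
Proof. exact: mcatt_unsus.1. Qed.

Lemma des_sus_sub Δ γ Γ : mhas_sub Δ γ Γ ->
  meq_sub (des_sus Δ) (msub_comp (unsus Γ) (des_sub (sus_sub Δ Γ γ)))
    (msub_comp γ (unsus Δ)) Γ.
Proof.
by move=> h; rewrite -des_sub_comp sus_sub_vars //; case/mcatt_unsus.2.2.2.1: h.
Qed.

Program Definition unsuspension :
    NatTrans (comp_functor Desuspension ReducedSuspension) (id_functor SynMCaTT) :=
  {| component := fun Γ : SynMCaTT =>
       exist _ (unsus (sval Γ)) (unsus_typed (svalP Γ)) |}.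
Next Obligation.
by move=> Δ Γ [γ h] /=; apply: meq_sub_sym; exact: des_sus_sub.
Qed.

(** The inverse of [unsus Γ]. *)
Fixpoint resus (Γ : mctx) : msub :=
  if Γ is A :: Γ' then
    (if nonunit A then mvar (size Γ') :: resus Γ' else resus Γ')
  else [:: mtt].

Lemma size_resus Γ : size (resus Γ) = size (sus_ctx Γ).
Proof. by elim: Γ => //= A Γ IH; case: nonunit; rewrite //= IH. Qed.

Lemma msub_tm_resus0 Γ : msub_tm (resus Γ) (mvar 0) = mtt.
Proof.
elim: Γ => //= A Γ IH; case: nonunit => //=.
by rewrite size_resus size_sus_ctx.
Qed.

Lemma resus_typed Γ : mwf_ctx Γ ->
  mhas_sub Γ (resus Γ) (des_sus Γ) /\
  meq_sub Γ (msub_comp (unsus Γ) (resus Γ)) (mid_sub (size Γ)) Γ.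
Proof.
elim: Γ => [|A Γ IH] w.
  split; last by apply: meq_nil.
  apply: (@msub_ext _ [::]); [exact: msub_nil | exact: mwf_unit mwf_nil |].
  exact: mty_tt.
inversion_clear w as [|? ? wΓ wA]; have [h e] := IH wΓ.
have w : mwf_ctx (A :: Γ) by exact: mwf_ext.
have h' := mhas_sub_weaken w h.
have e' : meq_sub (A :: Γ) (msub_comp (unsus Γ) (resus Γ)) (mid_sub (size Γ)) Γ.
  exact: (mcatt_weaken.2.2.2.2.2.2 _ _ _ _ e).
have hu := unsus_typed wΓ.
have cl : mclosed_sub (size (resus Γ)) (unsus Γ).
  by have := mhas_sub_scoped hu; rewrite size_resus size_des_ctx.
have hv : mhas_ty (A :: Γ) (mvar (size Γ)) A by apply: mty_var; rewrite //= eqxx.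
case: (boolP (nonunit A)) => [uA|uA] /=; last first.
  rewrite (negPf uA) /=; split=> //; apply: meq_ext => //.
  rewrite -/(msub_tm (resus Γ) (mvar 0)) msub_tm_resus0.
  case: A uA wA hv {w h' e'} => // _ wA hv.
  exact: meq_tm_sym (meq_eta hv).
have wS := sus_typed.2.1 _ _ wA.
have eA : meq_ty (A :: Γ) A (msub_ty (resus Γ) (des_ty (sus_ty (sus_vars Γ) A))).
  apply: meq_ty_sym; apply: meq_ty_trans.
    exact: meq_ty_sub h' (mcatt_unsus.2.1 _ _ wA).2.
  rewrite (msub_sub _ _).1; last by rewrite (mhas_sub_size hu) mwf_ty_scoped.
  rewrite -[X in meq_ty _ _ X](msub_id (size Γ)).1.
  by apply: (mwf_ty_functional wA _ e'); exact: mhas_sub_comp hu h'.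
rewrite uA /=; split.
  by apply: msub_ext => //; [exact: des_wf_ty | exact: mty_conv eA].
rewrite /msub_comp /= size_resus size_sus_ctx eqxx /=.
apply: meq_ext => //; first by rewrite -[map _ _]/(msub_comp _ _) msub_comp_cons.
apply: meq_tm_refl; rewrite -/(msub_comp _ _) msub_comp_cons //.
apply: mty_conv hv _; rewrite -[X in meq_ty _ X _](msub_id (size Γ)).1.
apply: meq_ty_sym.
by apply: (mwf_ty_functional wA _ e'); exact: mhas_sub_comp hu h'.
Qed.

Lemma resus_unsus Γ : mwf_ctx Γ ->
  meq_sub (des_sus Γ) (msub_comp (resus Γ) (unsus Γ))
    (mid_sub (size (des_sus Γ))) (des_sus Γ).
Proof.
elim: Γ => [|A Γ IH] w.
  apply: (@meq_ext _ [::] [::] [::]).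
  - by apply: meq_nil; exact: mwf_des_sus.
  - exact: mwf_unit mwf_nil.
  apply: meq_tm_sym; apply: meq_eta; apply: mty_var => //.
  exact: mwf_des_sus.
have wS := mwf_des_sus w.
inversion_clear w as [|? ? wΓ wA]; have e := IH wΓ.
have cl := mhas_sub_scoped (resus_typed wΓ).1.
move: wS; rewrite /=; case: (boolP (nonunit A)) => [uA|uA] /= wS; last first.
  by rewrite msub_comp_cons // size_map size_sus_vars.
rewrite size_map size_sus_vars eqxx /= msub_comp_cons ?size_map ?size_sus_vars //.
rewrite size_sus_ctx.
have e' := mcatt_weaken.2.2.2.2.2.2 _ _ _ _ e _ wS.
apply: meq_ext.
- by move: e'; rewrite size_map size_sus_ctx.
- by inversion_clear wS.
apply: meq_tm_refl; apply: mty_conv; last first.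
  apply: meq_ty_sym; apply: (fun w h => mwf_ty_functional w h e'); first by inversion_clear wS.
  exact: (mcatt_presup.2.2.2.2.2.2 _ _ _ _ e').1.
rewrite (msub_id _).1; apply: mty_var => //.
by rewrite /= size_map size_sus_ctx eqxx.
Qed.

Lemma unsuspension_is_iso (Γ : SynMCaTT) : is_iso (unsuspension Γ).
Proof.
case: Γ => Γ w; have [h e] := resus_typed w.
exists (exist (fun γ => mhas_sub Γ γ (des_sus Γ)) _ h); split=> //=.
exact: resus_unsus.
Qed.

(** * Models with a single object invert the bullet substitutions *)

Program Definition bullet_nat :
    NatTrans (comp_functor ReducedSuspension Desuspension) (id_functor SynCaTT) :=
  {| component := fun Θ : SynCaTT =>
       exist _ (bullet (sval Θ)) (bullet_typed (svalP Θ)) |}.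
Next Obligation.
move=> Γ Θ [θ h] /=; rewrite (sus_sub_vars (des_has_sub h)).
by symmetry; exact: sus_des.2.2.2.1 h.
Qed.

Lemma bullet_is_iso (F : Functor SynCaTT SetCat) :
  is_model F -> is_singleton (F disk0) ->
  forall Θ : SynCaTT, is_iso (fmor F (bullet_nat Θ)).
Proof.
move=> [tF pF] sF [Θ w].
elim: Θ w => [|A Θ IH] w.
  have [e ee] := catt_recast
    (X := ReducedSuspension (Desuspension (exist wf_ctx _ w))) (Y := disk0) erefl.
  have ie : is_iso e by exact: catt_recast_is_iso ee.
  apply: is_iso_terminal.
    by apply: (terminal_iso (fmor_iso F ie)); exact/is_terminal_SetCat.
  apply: tF => X; have [f uf] := empty_terminal (c := SynCaTT) X.
  exists (exist _ (sval f) (svalP f)) => g.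
  exact: (uf (exist _ (sval g) (svalP g))).
have [wΘ wA] : wf_ctx Θ /\ wf_ty Θ A by inversion_clear w.
pose X0 : SynCaTT := exist wf_ctx Θ wΘ; pose X : SynCaTT := exist wf_ctx (A :: Θ) w.
have {}IH : is_iso (fmor F (bullet_nat X0)) := IH wΘ.
pose p : mor X X0 := exist (fun γ => has_sub (A :: Θ) γ Θ) _ (has_sub_proj wA).
have [e ee] := catt_recast (X := X) (Y := extend (exist _ A wA : Ty X0)) erefl.
have ie : is_iso e by exact: catt_recast_is_iso ee.
have ep : display (exist _ A wA : Ty X0) ⊚ e ≈ p by rewrite /= ee sub_comp_idr.
case: A => [|A t u] in w wA X p e ee ie ep *.
  have [j ej] := catt_recast (X := ReducedSuspension (Desuspension X))
    (Y := ReducedSuspension (Desuspension X0)) erefl.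
  have ij : is_iso j by exact: catt_recast_is_iso ej.
  have ip : is_iso (fmor F p).
    pose D1 := @extend SynCaTT (empty _) (exist _ star (wf_star wf_nil)).
    have hv : has_ty (star :: Θ) (var (size Θ)) star.
      by apply: ty_var => //=; rewrite eqxx.
    pose v : mor X D1 := exist (fun γ => has_sub (star :: Θ) γ [:: star]) _
      (sub_ext (sub_nil w) (wf_star wf_nil) hv).
    pose c : mor X0 (empty SynCaTT) :=
      exist (fun γ => has_sub Θ γ [::]) _ (sub_nil wΘ).
    have /pF : is_pullback v p
        (display (exist _ star (wf_star wf_nil) : Ty (empty SynCaTT))) c.
      exact: (@catt_canonical_pullback _ _ _ _ _ _ _ _ star).
    apply: pullback_of_iso; apply: is_iso_terminal; last first.
      by apply: tF; exact: empty_terminal.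
    have [d ed] := catt_recast (X := D1) (Y := disk0) erefl.
    have id : is_iso d by exact: catt_recast_is_iso ed.
    by apply: (terminal_iso (fmor_iso F id)); exact/is_terminal_SetCat.
  apply: (is_iso_cancel_l ip).
  apply: (is_iso_eq (f := fmor F (bullet_nat X0) ⊚ fmor F j)); last first.
    by apply: is_iso_comp => //; exact: fmor_iso.
  rewrite -!(fmor_comp F); apply: fmor_proper => /=.
  by rewrite ej sub_comp_idr (has_sub_proj_cons _ (bullet_typed wΘ)).
pose SX := ReducedSuspension (Desuspension X).
pose SX0 := ReducedSuspension (Desuspension X0).
have hb := bullet_typed wΘ.
have eb : sus_ty (sus_vars (des_ctx Θ)) (des_ty (hom A t u)) =
    sub_ty (bullet Θ) (hom A t u) by exact: sus_des.2.1 wA.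
have hq : has_sub (sval SX) (id_sub (size (sval SX0))) (sval SX0).
  apply: has_sub_proj; exact: sus_typed.2.1 (des_wf_ty wA).
pose q : mor SX SX0 := exist (fun γ => has_sub (sval SX) γ (sval SX0)) _ hq.
have pb : is_pullback (bullet_nat X : mor SX X) q p (bullet_nat X0).
  apply: (@catt_canonical_pullback _ _ _ _ _ _ _ _ (hom A t u)) => //=.
    by congr (_ :: _); exact: eb.
  by rewrite /bullet /= size_sus_ctx.
have := display_pullback_preserved pF ie ep pb.
by move/pullback_sym; apply: pullback_of_iso.
Qed.

Theorem mainTheorem2 :
  exists (hD : forall F : Mod SynMCaTT,
            is_model (C := SynCaTT) (precomp_models Desuspension F))
         (hD1 : forall F : Mod SynMCaTT,
            one_object (corestrict (F := precomp_models Desuspension) hD F))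
         (hS : forall F : PointedMod,
            is_model (C := SynMCaTT)
              (comp_functor (precomp_models ReducedSuspension)
                 (inclusion one_object) F)),
    is_equivalence
      (corestrict (F := corestrict (F := precomp_models Desuspension) hD) hD1
         : Functor (Mod SynMCaTT) PointedMod)
      (corestrict (F := comp_functor (precomp_models ReducedSuspension)
                          (inclusion one_object)) hS
         : Functor PointedMod (Mod SynMCaTT)).
Proof.
have hD (F : Mod SynMCaTT) :
    is_model (C := SynCaTT) (precomp_models Desuspension F).
  exact: (desuspension_model (svalP F)).
have hD1 (F : Mod SynMCaTT) :
    one_object (corestrict (F := precomp_models Desuspension) hD F).
  by apply/is_terminal_SetCat; apply: (svalP F).1; exact: desuspension_disk0_terminal.
have hS (F : PointedMod) : is_model (C := SynMCaTT)
    (comp_functor (precomp_models ReducedSuspension) (inclusion one_object) F).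
  exact: (suspension_model (svalP (sval F)) (svalP F)).
pose KD : Functor (Mod SynMCaTT) PointedMod :=
  corestrict (F := corestrict (F := precomp_models Desuspension) hD) hD1.
pose KS : Functor PointedMod (Mod SynMCaTT) :=
  corestrict (F := comp_functor (precomp_models ReducedSuspension)
                     (inclusion one_object)) hS.
exists hD, hD1, hS; split.
- pose k F : mor (comp_functor KS KD F) (id_functor _ F) :=
    precomp_counit unsuspension (sval F).
  have nat F G (a : mor F G) :
      fmor (id_functor _) a ⊚ k F ≈ k G ⊚ fmor (comp_functor KS KD) a.
    exact: (precomp_counit_natural unsuspension a).
  exists (Build_NatTrans nat) => F; apply: FunCat_is_iso => X.
  by apply: fmor_iso; exact: unsuspension_is_iso.
- pose k F : mor (comp_functor KD KS F) (id_functor _ F) :=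
    precomp_counit bullet_nat (sval (sval F)).
  have nat F G (a : mor F G) :
      fmor (id_functor _) a ⊚ k F ≈ k G ⊚ fmor (comp_functor KD KS) a.
    exact: (precomp_counit_natural bullet_nat a).
  exists (Build_NatTrans nat) => F; apply: FunCat_is_iso => X.
  exact: (bullet_is_iso (svalP (sval F)) (svalP F)).
Qed.
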